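(* Let $\alpha$ be a partition with all parts $\ge 2$ and overlapping partition $p=(p_1,\dots,p_{\ell(\alpha)-1},0)$, and for $1\le i\le \ell(p)-1$ let $\varrho_i=1+\sum_{q=i+1}^{\ell(\alpha)}\alpha_q-p_{i+1}$. Then $[R_\alpha^p]=[\alpha,(|\alpha|-p_1,p_1)]$ if and only if either $\ell(p)<2$, or $\ell(p)\ge2$ and $$\sum_{j=1}^i[\varrho_i-\alpha_j]_+\ge p_{i+1}\quad\text{for every } 1\le i\le \ell(p)-1.$$
   Context: A partition $\alpha=(\alpha_1\ge\dots\ge\alpha_{\ell(\alpha)}>0)$ has length $\ell(\alpha)$ and size $|\alpha|$. A ribbon is a skew Young diagram (English convention) containing no $2\times2$ square. For a partition $\alpha$ with all parts $\ge2$, a ribbon $R_\alpha$ has rows, from top to bottom, of lengths $\alpha_1,\dots,\alpha_{\ell(\alpha)}$, consecutive rows sharing at most one column and non-consecutive rows sharing none. Its overlapping partition is $p=(p_1,\dots,p_{\ell(\alpha)-1},0)$ where $p_i$ is the number of columns of length two in the last $\ell(\alpha)-i+1$ rows; $\ell(p)$ is the number of nonzero parts of $p$. The ribbon is determined by $(\alpha,p)$ and denoted $R_\alpha^p$. For a skew shape $A$, $s_A=\sum_\nu c_A^\nu s_\nu$ and the Schur support is $[A]=\{\nu:c_A^\nu>0\}$. $\preceq$ is dominance order and $[\lambda,\mu]=\{\nu:\lambda\preceq\nu\preceq\mu\}$. For real $x$, $[x]_+=\max\{0,x\}$. *)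

(* Defs.v *)
From mathcomp Require Import all_boot all_order all_algebra.
From mathcomp Require Import mpoly.

Set Implicit Arguments.
Unset Strict Implicit.
Unset Printing Implicit Defensive.

Import Order.TTheory GRing.Theory Num.Theory.

Local Open Scope nat_scope.

Definition is_partition (s : seq nat) : bool := sorted geq s && (0 \notin s).

(* The entry with 1-based index [i], and 0 beyond the last entry; only used
   with [1 <= i]. *)
Definition part (s : seq nat) (i : nat) : nat := nth 0 s i.-1.

Definition num_nonzero (s : seq nat) : nat := count (fun x => 0 < x) s.

(* All partitions of [k]: they have at most [k] parts, each at most [k]. *)
Definition partitions (k : nat) : seq (seq nat) :=
  [seq s <- [seq map val t | t : k.-bseq 'I_k.+1 <- enum {: k.-bseq 'I_k.+1}]
     | is_partition s && (sumn s == k)].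

Lemma partitions_uniq k : uniq (partitions k).
Proof.
rewrite filter_uniq // map_inj_uniq ?enum_uniq // => s t /= eq_st.
by apply: val_inj; apply: (inj_map val_inj).
Qed.

Lemma mem_partitions k s :
  (s \in partitions k) = is_partition s && (sumn s == k).
Proof.
rewrite mem_filter andb_idr // => /andP[/andP[_ s_pos] /eqP sum_s].
have le_part x : x \in s -> x <= k.
  by rewrite -sum_s => xs; rewrite (perm_sumn (perm_to_rem xs)) leq_addr.
have le_size : size s <= k.
  rewrite -sum_s; elim: s s_pos {sum_s le_part} => //= x s IHs.
  by rewrite inE negb_or eq_sym -lt0n => /andP[x0 /IHs]; rewrite -add1n; apply: leq_add.
have size_t : size [seq inord x : 'I_k.+1 | x <- s] <= k by rewrite size_map.
apply/mapP; exists (Bseq size_t); first by rewrite mem_enum.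
rewrite /= -map_comp -[LHS]map_id; apply/eq_in_map => x xs /=.
by rewrite inordK // ltnS le_part.
Qed.

Definition dominated (lam nu : seq nat) : Prop :=
  sumn lam = sumn nu /\
  forall k : nat, sumn (take k lam) <= sumn (take k nu).

(* Trailing zeros in [lam] or [mu] do not affect the interval. *)
Definition in_dominance_interval (lam mu nu : seq nat) : Prop :=
  [/\ is_partition nu, dominated lam nu & dominated nu mu].

Definition is_skew_shape (lam mu : seq nat) : Prop :=
  [/\ is_partition lam, is_partition mu &
      forall i, 1 <= i -> part mu i <= part lam i].

(* The cells (row, column) of lam / mu, numbered from 1, in the English
   convention. *)
Definition diagram (lam mu : seq nat) : seq (nat * nat) :=
  [seq (i, j) | i <- iota 1 (size lam),
                j <- iota (part mu i).+1 (part lam i - part mu i)].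

Definition is_ssyt (D : seq (nat * nat)) (n : nat)
    (T : {ffun seq_sub D -> 'I_n}) : bool :=
  [forall x, forall y,
     (((val x).1 == (val y).1) && ((val x).2 < (val y).2) ==> (T x <= T y)) &&
     (((val x).2 == (val y).2) && ((val x).1 < (val y).1) ==> (T x < T y))].

Definition skew_schur (n : nat) (lam mu : seq nat) : {mpoly int[n]} :=
  (\sum_(T : {ffun seq_sub (diagram lam mu) -> 'I_n} | is_ssyt T)
     \prod_x 'X_(T x))%R.

Definition schur (n : nat) (nu : seq nat) : {mpoly int[n]} :=
  skew_schur n nu [::].

(* [c nu] is the coefficient of s_nu in s_{lam / mu}. An identity between
   symmetric functions is one that holds in every finite number of variables;
   as s_{lam / mu} is homogeneous, only the partitions of |lam / mu| occur. *)
Definition is_schur_expansion (lam mu : seq nat) (c : seq nat -> int) : Prop :=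
  let k := size (diagram lam mu) in
  (forall n : nat,
     skew_schur n lam mu = \sum_(nu <- partitions k) c nu *: schur n nu)%R /\
  (forall nu, nu \notin partitions k -> c nu = 0%R).

(* The Schur functions form a basis, so the expansion exists and is unique. *)
Definition in_schur_support (lam mu nu : seq nat) : Prop :=
  exists c : seq nat -> int, is_schur_expansion lam mu c /\ (0 < c nu)%R.

Definition no_2x2_square (D : seq (nat * nat)) : Prop :=
  forall i j, ~ [/\ (i, j) \in D, (i, j.+1) \in D,
                    (i.+1, j) \in D & (i.+1, j.+1) \in D].

Definition shared_columns (lam mu : seq nat) (r s : nat) : nat :=
  count (fun j => ((r, j) \in diagram lam mu) && ((s, j) \in diagram lam mu))
        (iota 1 (part lam 1)).

(* lam / mu is a ribbon with row lengths [alpha], from top to bottom. *)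
Definition is_ribbon (alpha lam mu : seq nat) : Prop :=
  [/\ is_skew_shape lam mu,
      no_2x2_square (diagram lam mu),
      alpha = [seq part lam i - part mu i | i <- iota 1 (size lam)],
      forall r, 1 <= r < size lam -> shared_columns lam mu r r.+1 <= 1 &
      forall r s, 1 <= r -> r.+1 < s <= size lam -> shared_columns lam mu r s = 0].

(* The number of cells of column [j] in the rows [i], [i.+1], ... *)
Definition column_length_from (lam mu : seq nat) (i j : nat) : nat :=
  count (fun x => (i <= x.1) && (x.2 == j)) (diagram lam mu).

Definition overlapping_partition (lam mu : seq nat) : seq nat :=
  [seq count (fun j => column_length_from lam mu i j == 2) (iota 1 (part lam 1))
     | i <- iota 1 (size lam)].

Definition pos_part (x : int) : int := Num.max 0%R x.

Definition varrho (alpha p : seq nat) (i : nat) : int :=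
  (1 + \sum_(i.+1 <= q < (size alpha).+1) (part alpha q)%:Z
     - (part p i.+1)%:Z)%R.

(* Main.v *)
Require Import Defs.
From mathcomp Require Import all_boot all_order all_algebra.
From mathcomp Require Import mpoly zify.

(** Reading the rows of the ribbon from top to bottom, each from right to left,
    turns its tableaux into words that are weakly decreasing along the rows and
    strictly increasing at the overlaps. Dropping an overlap condition, or
    replacing it by its opposite (which merges the two rows), gives a recursion
    that ends with products of complete homogeneous polynomials. Chains of
    horizontal strips satisfy the same recursion and, by the Pieri rule, the same
    initial conditions. Hence [c_nu] counts the chains
    [nu = nu^0 > nu^1 > ... > nu^l = 0] of horizontal strips of sizes
    [alpha_1, ..., alpha_l] in which every overlap forces a descent.

    With [A_i = alpha_i + ... + alpha_(l-1)] and [p_i] the number of overlaps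
    from row [i] on (indices from 0), such a chain exists if and only if [nu]
    dominates [alpha] and [nu_i + p_i <= A_i] for all [i]. Necessity holds because
    [nu_i] is at most the first row of [nu^i] and each descent puts a cell outside
    the first row. For sufficiency, [nu^1] is the most dominant partition that
    respects these bounds and misses the last cell of the last longest row of [nu].
    The inequality of the theorem for [i] says exactly that no partition that
    dominates [alpha] violates the bound at [i]. *)

Set Implicit Arguments.
Unset Strict Implicit.
Unset Printing Implicit Defensive.

Import Order.TTheory GRing.Theory Num.Theory.

(** * Partitions and horizontal strips *)

(** The support is defined by the existence of some expansion, so besides explicit coefficients the
    proof needs the linear independence of Schur polynomials.

    The quantity [varrho_i] is the smallest value of [nu_i] that breaks [nu_i + p_i <= A_i]. At this
    value the rows before [i] hold together at least the sum of the [max(alpha_j, varrho_i)], that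
    is, an excess of the sum of the [[varrho_i - alpha_j]_+] over [alpha], while row [i] leaves only
    [A_i - varrho_i = p_i - 1] cells to pay for it. A violation is possible exactly when the excess
    is less than [p_i]. The bound at [i = 0] is the upper end of the interval, and where [p_i = 0]
    the bound follows from dominance.

    The obstacle is sufficiency: a strip has to leave an admissible partition and also take part in
    the descents on both of its sides. A descent is therefore split into two demands on single
    strips: the strip removed first has a cell outside row 0, and the next one removes the end of a
    longest row. Each strip can then be chosen without knowing its successor. *)

Lemma sumn_take_nth (s : seq nat) k : sumn (take k s) = \sum_(i < k) nth 0 s i.
Proof.
elim: s k => [|x s IHs] [|k] //=; rewrite ?big_ord0 //.
  by rewrite big1 // => i _; rewrite nth_nil.
by rewrite big_ord_recl /= IHs.
Qed.

Lemma sumn_nth (s : seq nat) k : size s <= k -> \sum_(i < k) nth 0 s i = sumn s.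
Proof. by move=> lesk; rewrite -sumn_take_nth take_oversize. Qed.

Lemma sum_recr (f : nat -> nat) n : \sum_(i < n.+1) f i = \sum_(i < n) f i + f n.
Proof. exact: big_ord_recr. Qed.

Lemma is_partition_nth (s : seq nat) i :
  is_partition s -> nth 0 s i.+1 <= nth 0 s i.
Proof.
case/andP=> srt _; case: (ltnP i.+1 (size s)) => [lti|lei]; last by rewrite nth_default.
by have := (sortedP 0 srt) i lti.
Qed.

Lemma antimono_nth (f : nat -> nat) : (forall i, f i.+1 <= f i) ->
  forall i j, i <= j -> f j <= f i.
Proof.
move=> fd i j /subnK <-; elim: (j - i) => // d IH.
by rewrite addSn; apply: leq_trans (fd _) IH.
Qed.

Lemma part_anti s i j : is_partition s -> 0 < i -> i <= j -> part s j <= part s i.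
Proof.
by move=> ps i0 ij; apply: (antimono_nth (fun i => is_partition_nth i ps)); lia.
Qed.

Lemma is_partition_nth_gt0 s i : is_partition s -> (0 < nth 0 s i) = (i < size s).
Proof.
case/andP=> _ nz; case: (ltnP i (size s)) => [lti|lei]; last by rewrite nth_default.
by rewrite lt0n; apply: contra nz => /eqP <-; apply: mem_nth.
Qed.

Lemma partition_ext s t : is_partition s -> is_partition t ->
  (forall i, nth 0 s i = nth 0 t i) -> s = t.
Proof.
move=> ps pt eqst; apply: (@eq_from_nth _ 0) => [|i _]; last exact: eqst.
have lt i : (i < size s) = (i < size t).
  by rewrite -!is_partition_nth_gt0 // eqst.
by apply/eqP; rewrite eqn_leq leqNgt lt ltnn /= leqNgt -lt ltnn.
Qed.

(** Partitions are constructed as row functions; the zeros are filtered out because [is_partition]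
    forbids them. *)
Definition seq_of (f : nat -> nat) K := [seq x <- mkseq f K | 0 < x].

Lemma seq_ofP (f : nat -> nat) K : (forall i, f i.+1 <= f i) -> f K = 0 ->
  is_partition (seq_of f K) /\ (forall i, nth 0 (seq_of f K) i = f i).
Proof.
move=> fd f0; have fa := antimono_nth fd.
split.
  rewrite /is_partition mem_filter andbT sorted_filter //; last first.
    rewrite /mkseq; apply/(sortedP 0) => i; rewrite size_map size_iota => lti.
    have lti0 : i < K by apply: ltnW.
    by rewrite !(nth_map 0) ?size_iota ?nth_iota //; apply: fd.
  by move=> x y z /= xy yz; apply: leq_trans yz xy.
elim: K f fd f0 fa => [|K IHK] f fd f0 fa i.
  by rewrite nth_nil; apply/esym/eqP; rewrite -leqn0 -f0 fa.
rewrite /seq_of /mkseq /= (iotaDl 1 0) -map_comp.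
have := IHK (fun i => f i.+1) (fun i => fd _) f0 (fun i j ij => fa i.+1 j.+1 ij).
rewrite /seq_of /mkseq => IH.
have -> : [seq (f \o [eta addn 1]) i | i <- iota 0 K] = [seq f i.+1 | i <- iota 0 K] by [].
case: posnP => [f00|] /=; last by case: i => [|i] //= _; rewrite IH.
have fz j : f j = 0 by apply/eqP; rewrite -leqn0 -f00 fa.
by rewrite IH !fz.
Qed.

Lemma sumn_seq_of f K : (forall i, f i.+1 <= f i) -> f K = 0 ->
  sumn (seq_of f K) = \sum_(i < K) f i.
Proof.
move=> fd f0; have [_ nf] := seq_ofP fd f0.
rewrite -(@sumn_nth _ K) => [|]; first by apply: eq_bigr => i _; rewrite nf.
by rewrite size_filter -[X in _ <= X](size_mkseq f); apply: count_size.
Qed.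

Lemma size_partition_le s : is_partition s -> size s <= sumn s.
Proof.
case/andP=> _; elim: s => //= x s IHs; rewrite inE negb_or => /andP[x0 /IHs]; lia.
Qed.

(** Interlacing form of a horizontal strip. Beyond [size nu + size ka] all rows are 0, so the finite
    check covers every [i]. *)
Definition hstrip (nu ka : seq nat) :=
  all (fun i => nth 0 nu i.+1 <= nth 0 ka i <= nth 0 nu i) (iota 0 (size nu + size ka)).

Lemma hstripP nu ka :
  reflect (forall i, nth 0 nu i.+1 <= nth 0 ka i <= nth 0 nu i) (hstrip nu ka).
Proof.
apply: (iffP allP) => [H i|H i _]; last exact: H.
case: (ltnP i (size nu + size ka)) => [lti|lei]; first by apply: H; rewrite mem_iota.
by rewrite !nth_default //; lia.
Qed.

(* The strip [rho / nu] has a cell in a lower row than some cell of [nu / ka]: in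
   the standardization of the chain, the last entry of [nu / ka] is a descent. *)
Definition desc (ka nu rho : seq nat) :=
  has (fun j => (nth 0 nu j < nth 0 rho j)
         && has (fun i => nth 0 ka i < nth 0 nu i) (iota 0 j)) (iota 0 (size rho)).

Lemma descP ka nu rho :
  reflect (exists i j, [/\ i < j, nth 0 ka i < nth 0 nu i & nth 0 nu j < nth 0 rho j])
          (desc ka nu rho).
Proof.
apply: (iffP hasP) => [[j _ /andP[h /hasP[i]]]|[i [j [ij h1 h2]]]].
  by rewrite mem_iota => /andP[_ ij] h'; exists i, j.
exists j.
  rewrite mem_iota leq0n /= add0n ltnNge; apply: contraL h2 => le.
  by rewrite -leqNgt (nth_default _ le).
by rewrite h2; apply/hasP; exists i; rewrite ?mem_iota.
Qed.

Lemma hstrip_sumn nu ka : hstrip nu ka -> sumn ka <= sumn nu.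
Proof.
move/hstripP=> H; rewrite -(@sumn_nth ka (size nu + size ka)) ?leq_addl //.
rewrite -(@sumn_nth nu (size nu + size ka)) ?leq_addr //.
by apply: leq_sum => i _; case/andP: (H i).
Qed.

Definition partitions_upto M := undup (flatten [seq partitions k | k <- iota 0 M.+1]).

Lemma mem_partitions_upto M s :
  (s \in partitions_upto M) = is_partition s && (sumn s <= M).
Proof.
rewrite mem_undup; apply/flatten_mapP/andP => [[k]|[ps le]].
  by rewrite mem_iota => lek; rewrite mem_partitions => /andP[-> /eqP ->]; lia.
by exists (sumn s); rewrite ?mem_iota ?mem_partitions ?ps /=; lia.
Qed.

Lemma partitions_upto_uniq M : uniq (partitions_upto M).
Proof. exact: undup_uniq. Qed.

Lemma perm_partitions k M : k <= M ->
  perm_eq (partitions k) [seq s <- partitions_upto M | sumn s == k].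
Proof.
move=> le; apply: uniq_perm; rewrite ?partitions_uniq ?filter_uniq ?undup_uniq // => s.
by rewrite mem_partitions mem_filter mem_partitions_upto; case: eqP => [->|]; rewrite ?le ?andbT ?andbF.
Qed.

Lemma count_le_inj (T : eqType) (s1 s2 : seq T) (P Q : pred T) (f g : T -> T) :
  uniq s1 -> (forall x, x \in s1 -> P x -> (f x \in s2) /\ Q (f x) /\ g (f x) = x) ->
  count P s1 <= count Q s2.
Proof.
move=> u1 H; rewrite -!size_filter -(size_map f).
apply: uniq_leq_size => [|y].
  rewrite map_inj_in_uniq ?filter_uniq // => x y; rewrite !mem_filter.
  move=> /andP[Px xs] /andP[Py ys] e.
  by have [_ [_ <-]] := H x xs Px; have [_ [_ <-]] := H y ys Py; rewrite e.
case/mapP=> x; rewrite mem_filter => /andP[Px xs] ->.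
by have [h [h' _]] := H x xs Px; rewrite mem_filter h' h.
Qed.

(* [E] units distributed over boxes of capacities [d 0], [d 1], ..., filling the
   first boxes first. *)
Definition topfill (d : nat -> nat) E i := minn (d i) (E - \sum_(j < i) d j).

Lemma sum_topfill d E k : \sum_(i < k) topfill d E i = minn E (\sum_(i < k) d i).
Proof.
elim: k => [|k IH]; first by rewrite !big_ord0 minn0.
by rewrite !big_ord_recr /= IH /topfill; set s := (\sum_(i < k) d i)%N; clearbody s; lia.
Qed.

(** * The Pieri rule *)

Lemma sum_maxn_minn (f g : nat -> nat) K :
  \sum_(i < K) maxn (f i) (g i) + \sum_(i < K) minn (f i) (g i) =
  \sum_(i < K) f i + \sum_(i < K) g i.
Proof. by rewrite -!big_split /=; apply: eq_bigr => i _; lia. Qed.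

Lemma sum_recl (f : nat -> nat) n : \sum_(i < n.+1) f i = f 0 + \sum_(i < n) f i.+1.
Proof. exact: big_ord_recl. Qed.

Section LocalRule.
Variables (nu1 ka : seq nat) (a : nat).
Hypotheses (pn : is_partition nu1) (pk : is_partition ka).
Let K := (size nu1 + size ka).+1.
Let v i := nth 0 nu1 i.
Let k i := nth 0 ka i.

(* The local rule of the Robinson-Schensted-Knuth correspondence: each row is
   reflected in the interval of its admissible values. *)
Definition up_fun (ka1 : seq nat) i :=
  if i is i'.+1 then maxn (v i) (k i) + minn (v i') (k i') - nth 0 ka1 i'
  else maxn (v 0) (k 0) + (sumn ka1 + a - sumn ka).
Definition down_fun (nu : seq nat) i := maxn (v i.+1) (k i.+1) + minn (v i) (k i) - nth 0 nu i.+1.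
Definition up_seq ka1 := seq_of (up_fun ka1) K.
Definition down_seq nu := seq_of (down_fun nu) K.

Let vd i : v i.+1 <= v i. Proof. exact: is_partition_nth. Qed.
Let kd i : k i.+1 <= k i. Proof. exact: is_partition_nth. Qed.
Let vk0 i : K <= i.+1 -> v i = 0 /\ k i = 0.
Proof. by rewrite /K /v /k => le; rewrite !nth_default //; lia. Qed.

Let sum_vk : \sum_(i < K) maxn (v i) (k i) + \sum_(i < K) minn (v i) (k i) = sumn nu1 + sumn ka.
Proof. by rewrite sum_maxn_minn !sumn_nth // /K; lia. Qed.

(** Row [i] of the small partition and row [i.+1] of the large one have the same interval of
    admissible values, from [maxn (v i.+1) (k i.+1)] to [minn (v i) (k i)], so the reflection
    carries one to the other. Row 0 of the large partition has no upper bound and absorbs what the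
    size requires. *)
Lemma up_seqP ka1 : is_partition ka1 -> hstrip nu1 ka1 -> hstrip ka ka1 -> sumn ka <= sumn ka1 + a ->
  [/\ is_partition (up_seq ka1), sumn (up_seq ka1) = sumn nu1 + a,
      hstrip (up_seq ka1) nu1, hstrip (up_seq ka1) ka & forall i, nth 0 (up_seq ka1) i = up_fun ka1 i].
Proof.
move=> p1 /hstripP h1 /hstripP h2 le.
have fd i : up_fun ka1 i.+1 <= up_fun ka1 i.
  case: i => [|i] /=.
    have := h1 0; have := h2 0; have := vd 0; have := kd 0; rewrite -!/(v _) -!/(k _); lia.
  have := h1 i; have := h2 i; have := vd i; have := kd i.
  have := h1 i.+1; have := h2 i.+1; have := vd i.+1; have := kd i.+1; rewrite -!/(v _) -!/(k _); lia.
have f0 : up_fun ka1 K = 0.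
  rewrite /K /=; have [] := @vk0 (size nu1 + size ka); first by [].
  have [] := @vk0 (size nu1 + size ka).+1; first by rewrite /K; lia.
  by move=> -> -> -> ->.
have [pu nu] := seq_ofP fd f0; split=> //.
- rewrite sumn_seq_of // sum_recl /=.
  have e : \sum_(i < size nu1 + size ka) (up_fun ka1 i.+1) + sumn ka1 =
     \sum_(i < size nu1 + size ka) (maxn (v i.+1) (k i.+1)) + \sum_(i < size nu1 + size ka) minn (v i) (k i).
    rewrite -(@sumn_nth ka1 (size nu1 + size ka)); last first.
      rewrite leqNgt -is_partition_nth_gt0 //; have [] := @vk0 (size nu1 + size ka); first by [].
      by have := h1 (size nu1 + size ka); rewrite -!/(v _); lia.
    rewrite -!big_split /=; apply: eq_bigr => i _.
    by have := h1 i; have := h2 i; rewrite -!/(v _) -!/(k _); lia.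
  have := sum_vk; rewrite /K (sum_recl (fun i => maxn (v i) (k i))) [X in _ + X]big_ord_recr /=.
  have [v0 k0] := vk0 (leqnn K); rewrite v0 k0.
  move: e => /=; lia.
- apply/hstripP => i; rewrite !nu -/(v i) /=; have := h1 i; have := h2 i; rewrite -!/(v _) -!/(k _).
  case: i => [|i] /=; first by lia.
  have := h1 i; have := h2 i; have := vd i; have := kd i; rewrite -!/(v _) -!/(k _); lia.
- apply/hstripP => i; rewrite !nu -/(k i) /=; have := h1 i; have := h2 i; rewrite -!/(v _) -!/(k _).
  case: i => [|i] /=; first by lia.
  have := h1 i; have := h2 i; have := vd i; have := kd i; rewrite -!/(v _) -!/(k _); lia.
Qed.

Lemma down_seqP nu : is_partition nu -> hstrip nu nu1 -> hstrip nu ka -> sumn nu = sumn nu1 + a ->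
  [/\ is_partition (down_seq nu), hstrip nu1 (down_seq nu), hstrip ka (down_seq nu),
      (sumn (down_seq nu) + a - sumn ka) + maxn (v 0) (k 0) = nth 0 nu 0
      /\ sumn ka <= sumn (down_seq nu) + a &
      forall i, nth 0 (down_seq nu) i = down_fun nu i].
Proof.
move=> p1 /hstripP h1 /hstripP h2 sz.
have fd i : down_fun nu i.+1 <= down_fun nu i.
  have := h1 i; have := h2 i; have := h1 i.+1; have := h2 i.+1.
  have := h1 i.+2; have := h2 i.+2.
  have := vd i.+1; have := kd i.+1; have := vd i; have := kd i; rewrite -!/(v _) -!/(k _) /down_fun; lia.
have f0 : down_fun nu K = 0.
  rewrite /down_fun; have [] := @vk0 K.+1; first by lia.
  by have [] := @vk0 K; [lia | move=> -> -> -> ->].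
have [pu nth_d] := seq_ofP fd f0; split=> //.
- apply/hstripP => i; rewrite nth_d /down_fun; have := h1 i; have := h2 i; have := h1 i.+1; have := h2 i.+1.
  have := vd i; have := kd i; rewrite -!/(v _) -!/(k _); lia.
- apply/hstripP => i; rewrite nth_d /down_fun; have := h1 i; have := h2 i; have := h1 i.+1; have := h2 i.+1.
  have := vd i; have := kd i; rewrite -!/(v _) -!/(k _); lia.
have e : sumn (down_seq nu) + \sum_(i < K) nth 0 nu i.+1 =
     \sum_(i < K) (maxn (v i.+1) (k i.+1)) + \sum_(i < K) minn (v i) (k i).
  rewrite sumn_seq_of // -!big_split /=; apply: eq_bigr => i _; rewrite /down_fun.
  have := h1 i; have := h2 i; have := h1 i.+1; have := h2 i.+1.
  rewrite -!/(v _) -!/(k _); lia.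
have sn : nth 0 nu 0 + \sum_(i < K) nth 0 nu i.+1 = sumn nu.
  rewrite -(@sumn_nth nu K.+1) ?big_ord_recl //.
  rewrite leqNgt -is_partition_nth_gt0 //; have := h1 K; have [e0 _] := vk0 (leqnSn K).
  rewrite -!/(v _) e0; lia.
have sm : maxn (v 0) (k 0) + \sum_(i < K) (maxn (v i.+1) (k i.+1)) = \sum_(i < K) maxn (v i) (k i).
  have : \sum_(i < K.+1) maxn (v i) (k i) = \sum_(i < K) maxn (v i) (k i).
    by rewrite big_ord_recr /=; have [] := @vk0 K; [lia | move=> -> ->; rewrite addn0].
  by move <-; rewrite big_ord_recl.
have := sum_vk; have := h1 0; have := h2 0; rewrite -!/(v _) -!/(k _).
split; lia.
Qed.

(* Adding a strip commutes with removing one. *)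
Lemma local_rule_count :
  count (fun ka1 => [&& hstrip nu1 ka1, hstrip ka ka1 & sumn ka <= sumn ka1 + a]) (partitions_upto (sumn nu1))
  = count (fun nu => hstrip nu nu1 && hstrip nu ka) (partitions (sumn nu1 + a)).
Proof.
apply/eqP; rewrite eqn_leq; apply/andP; split.
- apply: (@count_le_inj _ _ _ _ _ up_seq down_seq); first exact: partitions_upto_uniq.
  move=> ka1; rewrite mem_partitions_upto => /andP[p1 le] /and3P[h1 h2 h3].
  have [q1 q2 q3 q4 q5] := up_seqP p1 h1 h2 h3.
  rewrite mem_partitions q1 q2 eqxx q3 q4; split=> //; split=> //.
  have [r1 r2 r3 r4 r5] := down_seqP q1 q3 q4 q2.
  apply: partition_ext => // i; rewrite r5 /down_fun q5 /=.
  by move/hstripP: h1 => /(_ i); move/hstripP: h2 => /(_ i); rewrite -!/(v _) -!/(k _); lia.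
- apply: (@count_le_inj _ _ _ _ _ down_seq up_seq); first exact: partitions_uniq.
  move=> nu; rewrite mem_partitions => /andP[p1 /eqP sz] /andP[h1 h2].
  have [q1 q2 q3 [q4 q4'] q5] := down_seqP p1 h1 h2 sz.
  rewrite mem_partitions_upto q1 (hstrip_sumn q2) q2 q3 q4'; split=> //; split=> //.
  have [r1 r2 r3 r4 r5] := up_seqP q1 q2 q3 q4'.
  apply: partition_ext => // -[|i]; rewrite r5 /=; first by rewrite -q4 addnC.
  rewrite q5 /down_fun.
  move/hstripP: h1 => h1; move/hstripP: h2 => h2; have := h1 i; have := h2 i; have := h1 i.+1; have := h2 i.+1.
  by rewrite -!/(v _) -!/(k _); lia.
Qed.

End LocalRule.

Local Open Scope ring_scope.

Lemma eq_big_in_seq (R : nmodType) (I : eqType) (r : seq I) (P : pred I) (F G : I -> R) :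
  (forall i, i \in r -> P i -> F i = G i) ->
  \sum_(i <- r | P i) F i = \sum_(i <- r | P i) G i.
Proof.
move=> FG; rewrite big_seq_cond [RHS]big_seq_cond.
by apply: eq_bigr => i /andP[]; apply: FG.
Qed.

Section Schur.
Variables (R : comRingType) (x : nat -> R).

(* The branching rule: [ka] is the shape of the entries below [n']. *)
Fixpoint schur_poly (n : nat) (nu : seq nat) : R :=
  if n is n'.+1 then
    \sum_(ka <- partitions_upto (sumn nu) | hstrip nu ka) x n' ^+ (sumn nu - sumn ka) * schur_poly n' ka
  else (nu == [::])%:R.

Fixpoint complete_poly (n a : nat) : R :=
  if n is n'.+1 then \sum_(i < a.+1) x n' ^+ (a - i) * complete_poly n' i else (a == 0%N)%:R.

Lemma complete_poly_rec n a : complete_poly n.+1 a.+1 = complete_poly n a.+1 + x n * complete_poly n.+1 a.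
Proof.
rewrite /= big_ord_recr /= subnn mul1r addrC; congr (_ + _).
rewrite mulr_sumr; apply: eq_bigr => i _; rewrite mulrA -exprS; congr (_ ^+ _ * _).
by have := ltn_ord i; lia.
Qed.

Lemma complete_poly0 n : complete_poly n 0 = 1.
Proof. by elim: n => [|n IH] //=; rewrite big_ord1 IH mulr1. Qed.

(** Induction on the number of variables: branching peels the last variable off both factors, the
    induction hypothesis adds a strip to the inner shape [ka1], and [local_rule_count] exchanges
    adding and removing. *)
Lemma pieri n a nu1 : is_partition nu1 ->
  complete_poly n a * schur_poly n nu1 = \sum_(nu <- partitions (sumn nu1 + a) | hstrip nu nu1) schur_poly n nu.
Proof.
elim: n a nu1 => [|n IHn] a nu1 p1.
  rewrite /=; case: a => [|a]; last first.
    rewrite mul0r big1_seq // => nu /andP[_]; rewrite mem_partitions => /andP[_].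
    by case: nu => //=; rewrite addnS.
  rewrite mul1r addn0; case: eqP => [->|nz].
    rewrite (perm_big [:: [::]]) /=; last first.
      apply: uniq_perm; rewrite ?partitions_uniq // => s; rewrite mem_partitions inE.
      by apply/andP/eqP => [[ps /eqP /= s0]|->] //; apply: size0nil; have := size_partition_le ps; lia.
    by rewrite big_cons big_nil /= addr0.
  rewrite big1_seq // => nu /andP[_]; rewrite mem_partitions => /andP[_ /eqP e].
  case: eqP => // e'; case: nz; move: e; rewrite e' /= => e; apply: size0nil.
  by have := size_partition_le p1; rewrite -e; lia.
set M := (sumn nu1 + a)%N.
have -> : complete_poly n.+1 a * schur_poly n.+1 nu1 =
  \sum_(ka1 <- partitions_upto (sumn nu1) | hstrip nu1 ka1)
   \sum_(ka <- partitions_upto M | hstrip ka ka1 && (sumn ka <= sumn ka1 + a)%N)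
     x n ^+ (M - sumn ka) * schur_poly n ka.
  rewrite /= mulr_sumr; apply: eq_big_in_seq => ka1.
  rewrite mem_partitions_upto => /andP[pk1 le1] h1.
  rewrite mulr_suml.
  (* The degree [i] is determined as the size of [ka / ka1]; summing over [i] leaves only the bound
     [sumn ka <= sumn ka1 + a]. *)
  transitivity (\sum_(i < a.+1) \sum_(ka <- partitions_upto M | hstrip ka ka1)
     if (sumn ka == sumn ka1 + i)%N then x n ^+ (M - sumn ka) * schur_poly n ka else 0).
    apply: eq_bigr => i _.
    rewrite -big_mkcondr -mulrA [complete_poly n i * _]mulrCA IHn // mulrA -exprD.
    have lei : (sumn ka1 + i <= M)%N by rewrite /M; have := ltn_ord i; lia.
    rewrite (perm_big _ (perm_partitions lei)) /= big_filter_cond mulr_sumr.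
    apply: eq_big => [ka|ka /andP[/eqP -> _]]; first by rewrite andbC.
    congr (_ ^+ _ * _).
    by rewrite /M; have := ltn_ord i; lia.
  rewrite exchange_big /= [RHS]big_mkcondr /=; apply: eq_bigr => ka hk.
  have les := hstrip_sumn hk.
  case: leqP => le.
    have lt : (sumn ka - sumn ka1 < a.+1)%N by lia.
    rewrite (bigD1 (Ordinal lt)) //= subnKC // eqxx big1 ?addr0 // => i ne.
    by case: eqP => // e; case/eqP: ne; apply: val_inj => /=; lia.
  by rewrite big1 // => i _; case: eqP => // e; have := ltn_ord i; lia.
rewrite (exchange_big_dep predT) //=.
transitivity (\sum_(nu <- partitions M | hstrip nu nu1) \sum_(ka <- partitions_upto M | hstrip nu ka)
     x n ^+ (M - sumn ka) * schur_poly n ka); last first.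
  apply: eq_big_in_seq => nu; rewrite mem_partitions.
  by case/andP=> _ /eqP ->.
rewrite [RHS](exchange_big_dep predT) //=.
apply: eq_big_in_seq => ka; rewrite mem_partitions_upto => /andP[pk lek] _.
(* Neither inner summand depends on its index any more, so only the numbers of possible [ka1] and
   [nu] have to agree. *)
rewrite !big_const_seq; congr (iter _ _ _).
exact: local_rule_count.
Qed.

End Schur.

Local Close Scope ring_scope.

(** * Schur polynomials by branching *)

Lemma mem_diagram lam mu i j :
  ((i, j) \in diagram lam mu) = (0 < i) && (part mu i < j <= part lam i).
Proof.
apply/allpairsPdep/andP => [[i' [j' [hi hj [-> ->]]]]|[hi hj]].
  by move: hi hj; rewrite !mem_iota; lia.
exists i, j; split=> //; rewrite mem_iota; last by lia.
rewrite hi /= add1n ltnS leqNgt; apply/negP => lt.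
move: hj; rewrite /part (nth_default 0 (_ : size lam <= i.-1)); lia.
Qed.

Lemma diagram_uniq lam mu : uniq (diagram lam mu).
Proof.
by apply: allpairs_uniq_dep => [|i _|]; rewrite ?iota_uniq // => -[i j] [i' j'] _ _ [-> ->].
Qed.

Lemma size_diagram lam mu :
  size (diagram lam mu) = sumn [seq part lam i - part mu i | i <- iota 1 (size lam)].
Proof.
rewrite size_allpairs_dep; congr (sumn _); apply: eq_map => i; exact: size_iota.
Qed.

Lemma size_diagram0 nu : size (diagram nu [::]) = sumn nu.
Proof.
rewrite size_diagram; congr (sumn _); apply: (@eq_from_nth _ 0).
  by rewrite size_map size_iota.
move=> i; rewrite size_map size_iota => lti; rewrite (nth_map 0) ?size_iota //.
by rewrite nth_iota // /part nth_nil subn0 add1n.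
Qed.

Lemma ssytP D n (T : {ffun seq_sub D -> 'I_n}) :
  reflect ((forall x y, (val x).1 = (val y).1 -> (val x).2 < (val y).2 -> T x <= T y) /\
           (forall x y, (val x).2 = (val y).2 -> (val x).1 < (val y).1 -> T x < T y))
    (is_ssyt T).
Proof.
apply: (iffP forallP) => [h|[h1 h2] x].
  split=> x y e l; have /forallP/(_ y)/andP[] := h x; rewrite e eqxx l //= => _.
apply/forallP=> y; apply/andP; split; apply/implyP => /andP[/eqP e l]; [exact: h1 | exact: h2].
Qed.

Local Open Scope ring_scope.

Lemma big_seq_sub (R : Type) (idx : R) (op : Monoid.com_law idx) (T : choiceType)
    (D : seq T) (f : T -> R) : uniq D ->
  \big[op/idx]_(x : seq_sub D) f (val x) = \big[op/idx]_(c <- D) f c.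
Proof.
move=> uD; rewrite -(big_map val predT f); apply: perm_big; apply: uniq_perm => //.
  by rewrite map_inj_uniq ?index_enum_uniq //; apply: val_inj.
move=> c; apply/mapP/idP => [[x _ ->]|cD]; first exact: valP.
by exists (SeqSub cD); rewrite ?mem_index_enum.
Qed.

Lemma mem_diagram0 s i j : ((i.+1, j.+1) \in diagram s [::]) = (j < nth 0%N s i)%N.
Proof. by rewrite mem_diagram /part nth_nil. Qed.

Lemma diagram0_inj ka ka' : is_partition ka -> is_partition ka' ->
  (forall c, (c \in diagram ka [::]) = (c \in diagram ka' [::])) -> ka = ka'.
Proof.
move=> p p' h; apply: partition_ext => // i.
have hh j := h (i.+1, j.+1).
have e j : (j < nth 0%N ka i)%N = (j < nth 0%N ka' i)%N by have := hh j; rewrite !mem_diagram0.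
by have := e (nth 0%N ka i); have := e (nth 0%N ka' i); rewrite !ltnn; lia.
Qed.

Lemma cell_ge1 ka c : c \in diagram ka [::] -> exists i j, c = (i.+1, j.+1).
Proof. by case: c => -[|i] [|j]; rewrite mem_diagram // ?andbF // => _; exists i, j. Qed.

Lemma row_prefix (P : nat -> bool) N : (forall j, P j.+1 -> P j) -> (forall j, P j -> (j < N)%N) ->
  exists2 k, (k <= N)%N & forall j, P j = (j < k)%N.
Proof.
move=> Pd PN; have ex : exists k, ~~ P k by exists N; apply/negP => /PN; rewrite ltnn.
case: (ex_minnP ex) => k Pk mk; exists k.
  by apply: mk; apply/negP => /PN; rewrite ltnn.
move=> j; case: ltnP => [lt|le]; first by apply: contraTT lt => /mk; rewrite -leqNgt.
apply/negbTE; rewrite -(subnK le); elim: (j - k)%N => // d IH.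
by rewrite addSn; apply: contra IH; apply: Pd.
Qed.

Section Bridge.
Variable n : nat.

(** [schur_poly] and [words] take variables indexed by [nat], so those of the polynomial ring are
    extended by 0. *)
Definition var_at (i : nat) : {mpoly int[n]} := if insub i is Some o then 'X_(o : 'I_n) else 0.

Lemma var_at_ord (o : 'I_n) : var_at o = 'X_o.
Proof. by rewrite /var_at insubT //= => h; congr ('X_ _); apply: val_inj. Qed.

Lemma prod_var_at (D : seq (nat * nat)) (T : {ffun seq_sub D -> 'I_n}) :
  \prod_x 'X_(T x) = \prod_x var_at (T x) :> {mpoly int[n]}.
Proof. by apply: eq_bigr => x _; rewrite var_at_ord. Qed.

Section Step.
Variables (m : nat) (nu : seq nat).
Hypothesis pn : is_partition nu.
Notation D := (diagram nu [::]).

Definition compat (T : {ffun seq_sub D -> 'I_n}) (ka : seq nat) :=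
  [forall x, (T x < m)%N == (val x \in diagram ka [::])].

(** Rows increase weakly, so the entries below [m] form a prefix of each row. The other entries all
    equal [m], and no column contains two of them, which makes their cells a horizontal strip. *)
Lemma compat_exists (T : {ffun seq_sub D -> 'I_n}) : is_ssyt T -> (forall x, (T x < m.+1)%N) ->
  exists ka, [/\ is_partition ka, hstrip nu ka & compat T ka].
Proof.
move=> /ssytP[hr hc] hm.
pose small i j := if insub (i.+1, j.+1) is Some x then (T x < m)%N else false.
have smallP i j (x : seq_sub D) : val x = (i.+1, j.+1) -> small i j = (T x < m)%N.
  move=> e; rewrite /small -e insubT ?(valP x) // => h.
  by congr (T _ < _)%N; apply: val_inj.
have small_lt i j : small i j -> (j < nth 0%N nu i)%N.
  by rewrite /small; case: insubP => // x; rewrite mem_diagram0.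
have cellP i j : (j < nth 0%N nu i)%N -> exists2 x : seq_sub D, val x = (i.+1, j.+1) & small i j = (T x < m)%N.
  rewrite -mem_diagram0 => h; exists (SeqSub h) => //; exact: smallP.
have row_ex i : exists k, (k <= nth 0%N nu i)%N && [forall j : 'I_(nth 0%N nu i), small i j == (j < k)%N].
  have [|//|k lek Pk] := @row_prefix (small i) (nth 0%N nu i); last 2 first.
  - exact: small_lt.
  - by exists k; rewrite lek; apply/forallP => j; rewrite Pk.
  move=> j hj; have ltj := small_lt _ _ hj.
  have [x ex sx] := cellP _ _ ltj; have [y ey sy] := cellP i j (ltnW ltj).
  rewrite sx in hj; rewrite sy; apply: leq_ltn_trans hj.
  by apply: hr; rewrite ex ey.
pose f i := xchoose (row_ex i).
have f_le i : (f i <= nth 0%N nu i)%N by case/andP: (xchooseP (row_ex i)).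
have f_P i j : small i j = (j < f i)%N.
  case: (ltnP j (nth 0%N nu i)) => [lt|le].
    by case/andP: (xchooseP (row_ex i)) => _ /forallP/(_ (Ordinal lt))/eqP.
  have := f_le i; have := @small_lt i j; case: (small i j) => [/(_ isT)|_]; lia.
(* Otherwise the cells in column [f i] of rows [i] and [i.+1] (counted from 0) both exist, the upper
   one has entry [m], and the lower one would have to exceed it. *)
have f_hs i : (nth 0%N nu i.+1 <= f i)%N.
  rewrite leqNgt -[X in ~~ X]ltnS; apply/negP => lt.
  have lt1 : (f i < nth 0%N nu i.+1)%N by lia.
  have lt2 : (f i < nth 0%N nu i)%N by apply: leq_trans lt1 (is_partition_nth _ pn).
  have [x ex sx] := cellP _ _ lt1; have [y ey sy] := cellP _ _ lt2.
  have : (T y < T x)%N by apply: hc; rewrite ex ey.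
  by have := hm x; have := sy; rewrite f_P; lia.
have fd i : (f i.+1 <= f i)%N by apply: leq_trans (f_le _) (f_hs _).
have f0 : f (size nu) = 0%N.
  by apply/eqP; rewrite -leqn0 -(nth_default 0%N (leqnn (size nu))) f_le.
have [pf nf] := seq_ofP fd f0; exists (seq_of f (size nu)); split=> //.
  by apply/hstripP => i; rewrite nf f_hs f_le.
apply/forallP => x; have [i [j e]] := cell_ge1 (valP x).
by rewrite e mem_diagram0 nf -f_P (smallP _ _ _ e).
Qed.

Section FixKa.
Variable ka : seq nat.
Hypotheses (ltmn : (m < n)%N) (hk : hstrip nu ka).
Notation E := (diagram ka [::]).

Lemma sub_diag c : c \in E -> c \in D.
Proof.
move=> cE; have [i [j e]] := cell_ge1 cE; move: cE; rewrite e !mem_diagram0.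
by case/andP: (hstripP _ _ hk i) => _ le lt; apply: leq_trans le.
Qed.

Definition wid (y : seq_sub E) : seq_sub D := SeqSub (sub_diag (valP y)).
Definition ext (T : {ffun seq_sub E -> 'I_n}) : {ffun seq_sub D -> 'I_n} :=
  [ffun x => if insub (val x) is Some y then T y else Ordinal ltmn].
Definition restr (T : {ffun seq_sub D -> 'I_n}) : {ffun seq_sub E -> 'I_n} :=
  [ffun y => T (wid y)].

Lemma ext_in (T : {ffun seq_sub E -> 'I_n}) x y : val x = val y -> ext T x = T y.
Proof.
move=> e; rewrite ffunE e insubT ?(valP y) // => h; congr (T _); exact: val_inj.
Qed.

Lemma ext_out (T : {ffun seq_sub E -> 'I_n}) x : val x \notin E -> ext T x = m :> nat.
Proof. by move=> h; rewrite ffunE insubN. Qed.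

(** Deleting the entries [m] and filling the strip [nu / ka] with [m] are inverse to each other; the
    strip contributes one factor [var_at m] per cell. *)
Lemma sum_compat :
  \sum_(T : {ffun seq_sub D -> 'I_n} | [&& is_ssyt T, [forall x, (T x < m.+1)%N] & compat T ka])
     \prod_x 'X_(T x) =
  var_at m ^+ (sumn nu - sumn ka) *
  \sum_(T : {ffun seq_sub E -> 'I_n} | is_ssyt T && [forall x, (T x < m)%N]) \prod_x 'X_(T x)
  :> {mpoly int[n]}.
Proof.
rewrite (reindex_onto ext restr) /=; last first.
  move=> T /and3P[_ /forallP hm /forallP hc]; apply/ffunP => x; apply: val_inj => /=.
  case: (boolP (val x \in E)) => h.
    rewrite (@ext_in _ x (SeqSub h)) // ffunE /=; congr (val (T _)); exact: val_inj.
  rewrite ext_out //; have := hc x; have := hm x; rewrite (negbTE h).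
  by case: (ltnP (T x) m) => //; rewrite ltnS => le1 le2 _; apply/eqP; rewrite eqn_leq le1.
rewrite mulr_sumr; apply: eq_big => [T|T _].
  apply/andP/andP => [[/and3P[/ssytP[hr hc] _ /forallP hcc] _]|[/ssytP[hr hc] /forallP hm]].
    have e y : ext T (wid y) = T y by apply: ext_in.
    split; first (apply/ssytP; split=> x y e1 l; rewrite -!e; [exact: hr | exact: hc]).
    by apply/forallP => y; rewrite -e (eqP (hcc _)) /= (valP y).
  split; last first.
    by apply/eqP/ffunP => y; rewrite ffunE; apply: ext_in.
  apply/and3P; split; last first.
  - apply/forallP => x; case: (boolP (val x \in E)) => h.
      by rewrite (@ext_in _ x (SeqSub h)) // hm.
    by rewrite ext_out // ltnn.
  - apply/forallP => x; case: (boolP (val x \in E)) => h.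
      by rewrite (@ext_in _ x (SeqSub h)) //; apply: leq_trans (hm _) _.
    by rewrite ext_out.
  apply/ssytP; split=> x y e l.
  - case: (boolP (val y \in E)) => hy; last first.
      rewrite (ext_out _ hy); case: (boolP (val x \in E)) => h; last by rewrite ext_out.
      by rewrite (@ext_in _ x (SeqSub h)) // ltnW.
    have hx : val x \in E.
      have [i [j ex]] := cell_ge1 (valP x); have [i' [j' ey]] := cell_ge1 (valP y).
      move: e l hy; rewrite ex ey /= => -[->]; rewrite !mem_diagram0; lia.
    by rewrite (@ext_in _ x (SeqSub hx)) // (@ext_in _ y (SeqSub hy)) //; apply: hr.
  - have [i [j ex]] := cell_ge1 (valP x); have [i' [j' ey]] := cell_ge1 (valP y).
    have hx : val x \in E.
      have := valP y; move: e l; rewrite ex ey /= => -[->] l; rewrite !mem_diagram0 => l'.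
      apply: leq_trans l' _; case/andP: (hstripP _ _ hk i) => le _; apply: leq_trans le.
      by apply: (antimono_nth (fun i => is_partition_nth i pn)); lia.
    rewrite (@ext_in _ x (SeqSub hx)) //; case: (boolP (val y \in E)) => hy; last first.
      by rewrite (ext_out _ hy).
    by rewrite (@ext_in _ y (SeqSub hy)) //; apply: hc.
rewrite !prod_var_at.
pose f c := if insub c is Some y then var_at (T (y : seq_sub E)) else var_at m.
transitivity (\prod_(x : seq_sub D) f (val x)).
  by apply: eq_bigr => x _; rewrite ffunE /f; case: insubP.
rewrite big_seq_sub ?diagram_uniq //.
have pe : perm_eq D (E ++ [seq c <- D | c \notin E]).
  apply: uniq_perm; rewrite ?diagram_uniq // ?cat_uniq ?filter_uniq ?diagram_uniq //=.
    by rewrite andbT; apply/hasPn => c; rewrite mem_filter => /andP[].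
  move=> c; rewrite mem_cat mem_filter; case: (boolP (c \in E)) => //= /sub_diag; exact.
rewrite (perm_big _ pe) big_cat /= mulrC; congr (_ * _).
  rewrite big_filter (eq_bigr (fun=> var_at m)); last by move=> c h; rewrite /f insubN.
  rewrite -big_filter big_const_seq count_predT iter_mulr_1; congr (_ ^+ _).
  by have := perm_size pe; rewrite size_cat !size_diagram0 => ->; rewrite addKn.
rewrite -big_seq_sub ?diagram_uniq //; apply: eq_bigr => y _.
by rewrite /f insubT ?(valP y) // => h; congr (var_at (T _)); apply: val_inj.
Qed.

End FixKa.
End Step.

(** The ring keeps its [n] variables while the bound [m] on the entries runs through the induction;
    [m = n] gives the Schur polynomial. *)
Lemma schur_upto m nu : (m <= n)%N -> is_partition nu ->
  \sum_(T : {ffun seq_sub (diagram nu [::]) -> 'I_n} | is_ssyt T && [forall x, (T x < m)%N])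
     \prod_x 'X_(T x) = schur_poly var_at m nu.
Proof.
elim: m nu => [|m IHm] nu lem pn.
  rewrite /=; case: eqP => [->|nz].
    have e0 (x : seq_sub (diagram [::] [::])) : False by have := valP x.
    rewrite (big_pred1 [ffun x => False_rect _ (e0 x)]) => [|T].
      by rewrite big1 // => x; case: (e0 x).
    rewrite /= [RHS](_ : _ = true); last by apply/eqP/ffunP => x; case: (e0 x).
    by apply/andP; split; [apply/ssytP; split=> x; case: (e0 x) | apply/forallP=> x; case: (e0 x)].
  rewrite big_pred0 // => T; apply/negbTE; rewrite negb_and; apply/orP; right.
  apply/forallPn.
  have h : (1, 1)%N \in diagram nu [::].
    rewrite mem_diagram0 is_partition_nth_gt0 //; by case: (nu) nz.
  by exists (SeqSub h).
rewrite /=.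
transitivity (\sum_(ka <- partitions_upto (sumn nu) | hstrip nu ka)
  \sum_(T : {ffun seq_sub (diagram nu [::]) -> 'I_n} |
      [&& is_ssyt T, [forall x, (T x < m.+1)%N] & compat m T ka]) \prod_x 'X_(T x) : {mpoly int[n]}).
  under [RHS]eq_bigr => ka hk do under eq_bigl => T do rewrite andbA.
  under [RHS]eq_bigr => ka hk do rewrite big_mkcondr /=.
  rewrite exchange_big /=; apply: eq_bigr => T /andP[sT /forallP hT].
  have [ka [pk hk cT]] := compat_exists pn sT hT.
  have kin : ka \in partitions_upto (sumn nu) by rewrite mem_partitions_upto pk hstrip_sumn.
  rewrite [RHS]big_mkcond [RHS](bigD1_seq ka) ?partitions_upto_uniq //= hk cT [X in _ + X]big1_seq ?addr0 // => ka'.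
  rewrite mem_partitions_upto => /andP[ne /andP[pk' _]].
  case: ifP => // h'; case: ifP => // cT'; case/eqP: ne.
  apply: diagram0_inj => // c.
  case: (boolP (c \in diagram nu [::])) => h.
    by have /forallP/(_ (SeqSub h))/eqP <- := cT'; have /forallP/(_ (SeqSub h))/eqP <- := cT.
  by rewrite (contraNF (@sub_diag _ _ hk c) h) (contraNF (@sub_diag _ _ h' c) h).
apply: eq_big_in_seq => ka; rewrite mem_partitions_upto => /andP[pk _] hk.
by rewrite sum_compat // IHm // ltnW.
Qed.

Lemma schurE nu : is_partition nu -> schur n nu = schur_poly var_at n nu.
Proof.
move=> pn; rewrite -schur_upto // /schur /skew_schur; apply: eq_bigl => T.
by rewrite andb_idr // => _; apply/forallP.
Qed.

End Bridge.

Local Close Scope ring_scope.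

(** * Ribbon tableaux as words *)

Variant adjacency := Weak | Strict | Free.

Definition adjacent_ok k (a b : nat) :=
  match k with Weak => b <= a | Strict => a < b | Free => true end.

Fixpoint satisfies (c : seq adjacency) (s : seq nat) : bool :=
  if c is k :: c' then
    if s is a :: s' then (if s' is b :: _ then adjacent_ok k a b else true) && satisfies c' s' else true
  else true.

(* [(a, b) :: L] stands for a row of length [a] followed by the rows [L]; [b] tells
   whether this row overlaps the next one. *)
Fixpoint conds (L : seq (nat * bool)) : seq adjacency :=
  if L is (a, b) :: L' then
    nseq a.-1 Weak ++ (if L' is [::] then [::] else (if b then Strict else Free) :: conds L')
  else [::].

Lemma satisfies_nseq m u : size u = m.+1 -> satisfies (nseq m Weak) u = sorted geq u.
Proof.
elim: m u => [|m IH] [|a [|b u]] //= [e].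
by rewrite IH //= e.
Qed.

Lemma satisfies_cat m k c u v : size u = m.+1 -> 0 < size v ->
  satisfies (nseq m Weak ++ k :: c) (u ++ v) =
  [&& sorted geq u, adjacent_ok k (last 0 u) (head 0 v) & satisfies c v].
Proof.
elim: m u => [|m IH] [|a [|b u]] //= e v0; first by case: v v0.
by rewrite (IH (b :: u)) //=; [rewrite andbA | case: e => ->].
Qed.

Local Open Scope ring_scope.

Section Words.
Variables (R : comRingType) (x : nat -> R) (n : nat).

Fixpoint words_from (c : seq adjacency) (a : nat) : R :=
  if c is k :: c' then x a * \sum_(b < n | adjacent_ok k a b) words_from c' b else x a.

Definition words c := \sum_(a < n) words_from c a.
(** [conds [::]] is empty, which is also the condition list of a one-letter word; the empty ribbon
    therefore needs its own value. *)
Definition ribbon_words L := if L is [::] then 1 else words (conds L).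

(** Two letters satisfy exactly one of the [Weak] and [Strict] conditions. *)
Lemma words_from_split c1 c2 a : words_from (c1 ++ Free :: c2) a = words_from (c1 ++ Weak :: c2) a + words_from (c1 ++ Strict :: c2) a.
Proof.
elim: c1 a => [|k c1 IH] a /=; last first.
  by rewrite -mulrDr -big_split /=; congr (_ * _); apply: eq_bigr => b _; apply: IH.
rewrite -mulrDr (bigID (fun b : 'I_n => (b <= a)%N)) /=; congr (_ * (_ + _)).
by apply: eq_bigl => b; rewrite -ltnNge.
Qed.

Lemma words_split c1 c2 : words (c1 ++ Free :: c2) = words (c1 ++ Weak :: c2) + words (c1 ++ Strict :: c2).
Proof. by rewrite -big_split; apply: eq_bigr => a _; apply: words_from_split. Qed.

Lemma words_cat m c : words (nseq m Weak ++ Free :: c) = words (nseq m Weak) * words c.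
Proof.
rewrite /words mulr_suml; apply: eq_bigr => a _; elim: m (a : nat) => [|m IH] {}a //=.
by rewrite -mulrA mulr_suml; congr (_ * _); apply: eq_bigr => b _; apply: IH.
Qed.

(** A weakly decreasing word is classified by its first letter [a], its largest; the remaining
    letters use the variables up to [a]. *)
Lemma sum_complete_poly N m : \sum_(a < N) x a * complete_poly x a.+1 m = complete_poly x N m.+1.
Proof.
elim: N => [|N IH]; first by rewrite big_ord0.
by rewrite big_ord_recr [in LHS]/= IH complete_poly_rec.
Qed.

Lemma words_from_run m (a : nat) : (a < n)%N -> words_from (nseq m Weak) a = x a * complete_poly x a.+1 m.
Proof.
elim: m a => [|m IH] a lta; first by rewrite complete_poly0 mulr1.
rewrite [LHS]/=; congr (_ * _); rewrite -sum_complete_poly.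
rewrite (big_ord_widen_cond n (fun=> true) (fun b => x b * complete_poly x b.+1 m)) //.
by apply: eq_bigr => b _; apply: IH.
Qed.

Lemma words_run m : words (nseq m Weak) = complete_poly x n m.+1.
Proof. by rewrite -sum_complete_poly; apply: eq_bigr => a _; apply: words_from_run. Qed.

Lemma sum_tuple_cons (T : finType) m (P : pred (m.+1.-tuple T)) (F : m.+1.-tuple T -> R) :
  \sum_(t | P t) F t =
  \sum_(a : T) \sum_(t : m.-tuple T | P [tuple of a :: t]) F [tuple of a :: t].
Proof.
rewrite pair_big_dep /= (reindex (fun p : T * m.-tuple T => [tuple of p.1 :: p.2])) //=.
exists (fun t : m.+1.-tuple T => (thead t, [tuple of behead t])) => [[a t] _|t _] /=.
  by congr (_, _); apply: val_inj.
by rewrite -tuple_eta.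
Qed.

Lemma words_from_tuple c a : words_from c a =
  \sum_(t : (size c).-tuple 'I_n | satisfies c (a :: map val t)) x a * \prod_(i <- t) x (val i).
Proof.
elim: c a => [|k c IH] a /=.
  rewrite (big_pred1 [tuple]) => [|t]; first by rewrite big_nil mulr1.
  by rewrite [t]tuple0 /= eqxx.
rewrite sum_tuple_cons mulr_sumr big_mkcond /=; apply: eq_bigr => b _.
case: ifP => okab; last by rewrite big_pred0.
by rewrite IH mulr_sumr /=; apply: eq_bigr => t _; rewrite big_cons.
Qed.

Lemma words_tuple c : words c =
  \sum_(t : (size c).+1.-tuple 'I_n | satisfies c (map val t)) \prod_(i <- t) x (val i).
Proof.
rewrite sum_tuple_cons; apply: eq_bigr => a _; rewrite words_from_tuple.
by apply: eq_bigr => t _; rewrite /= big_cons.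
Qed.

End Words.

Section Reading.
Variables (n : nat) (D E : seq (nat * nat)).
Hypotheses (uE : uniq E) (eqDE : D =i E).

Definition cell (k : 'I_(size E)) : seq_sub D.
Proof. by refine (@SeqSub _ _ (tnth (in_tuple E) k) _); rewrite eqDE mem_tnth. Defined.

Lemma cell_rank_proof (y : seq_sub D) : (index (val y) E < size E)%N.
Proof. by rewrite index_mem -eqDE (valP y). Qed.

Definition cell_rank (y : seq_sub D) : 'I_(size E) := Ordinal (cell_rank_proof y).

Lemma cellK : cancel cell cell_rank.
Proof.
move=> k; apply: val_inj => /=; rewrite (tnth_nth (0, 0)%N) /= index_uniq //.
Qed.

Lemma cell_rankK : cancel cell_rank cell.
Proof.
move=> y; apply: val_inj => /=; rewrite (tnth_nth (0, 0)%N) /= nth_index // -eqDE.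
exact: (valP y).
Qed.

Definition word (T : {ffun seq_sub D -> 'I_n}) : (size E).-tuple 'I_n :=
  [tuple T (cell k) | k < size E].

Definition filling (T : {ffun seq_sub D -> 'I_n}) (c : nat * nat) : nat :=
  if insub c is Some y then val (T y) else 0%N.

Lemma fillingE T (y : seq_sub D) : filling T (val y) = T y.
Proof. by rewrite /filling insubT ?(valP y) // => h; congr (val (T _)); apply: val_inj. Qed.

Lemma word_filling T : map val (word T) = [seq filling T c | c <- E].
Proof.
have sz : size (map val (word T)) = size E by rewrite size_map size_tuple.
apply: (@eq_from_nth _ 0%N); rewrite sz ?size_map // => i lti.
have -> : i = Ordinal lti by [].
rewrite (nth_map (T (cell (Ordinal lti)))) ?size_tuple //.
rewrite -(tnth_nth _ (word T) (Ordinal lti)) tnth_mktuple (nth_map (0, 0)%N) //.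
rewrite -(tnth_nth _ (in_tuple E) (Ordinal lti)); exact: esym (fillingE T (cell (Ordinal lti))).
Qed.

Lemma sum_word (P : pred {ffun seq_sub D -> 'I_n}) (Q : pred (seq nat)) :
  (forall T, P T = Q [seq filling T c | c <- E]) ->
  \sum_(T | P T) \prod_y 'X_(T y) =
  \sum_(t : (size E).-tuple 'I_n | Q (map val t)) \prod_(i <- t) var_at n (val i)
  :> {mpoly int[n]}.
Proof.
move=> PQ.
have wK : cancel (fun t : (size E).-tuple 'I_n => [ffun y => tnth t (cell_rank y)]) word.
  by move=> t; apply: eq_from_tnth => k; rewrite tnth_mktuple ffunE cellK.
have Kw : cancel word (fun t : (size E).-tuple 'I_n => [ffun y => tnth t (cell_rank y)]).
  by move=> T; apply/ffunP => y; rewrite ffunE tnth_mktuple cell_rankK.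
rewrite [RHS](reindex word); last by exists (fun t => [ffun y => tnth t (cell_rank y)]) => t _.
apply: eq_big => [T|T _]; first by rewrite PQ word_filling.
rewrite (@big_tuple _ _ _ _ _ (word T)) (reindex cell) /=; last by exists cell_rank => y _; [apply: cellK | apply: cell_rankK].
by apply: eq_bigr => k _; rewrite tnth_mktuple var_at_ord.
Qed.

End Reading.

Local Close Scope ring_scope.

Section Ribbon.
Variables (lam mu : seq nat).
Hypotheses (plam : is_partition lam) (pmu : is_partition mu).
Hypothesis row_ge2 : forall i, 1 <= i <= size lam -> part mu i + 2 <= part lam i.
Hypothesis row_next : forall i, 1 <= i -> part lam i.+1 <= (part mu i).+1.
Notation l := (size lam).

(** By [row_next] row [i.+1] ends at the latest in the first column of row [i], so the inequality
    says that these two columns coincide. *)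
Definition overlap i := part mu i < part lam i.+1.
Definition row_cells r := [seq (r, j) | j <- rev (iota (part mu r).+1 (part lam r - part mu r))].
Definition reading i k := flatten [seq row_cells r | r <- iota i k].
Definition rows i k := [seq (part lam r - part mu r, overlap r) | r <- iota i k].

Lemma mem_reading i k c : (c \in reading i k) = (i <= c.1 < i + k) && (part mu c.1 < c.2 <= part lam c.1).
Proof.
apply/flatten_mapP/andP => [[r]|[h1 h2]].
  by rewrite mem_iota => h /mapP[j]; rewrite mem_rev mem_iota => hj -> /=; lia.
exists c.1; rewrite ?mem_iota //; apply/mapP; exists c.2; last by case: (c).
by rewrite mem_rev mem_iota; lia.
Qed.

Lemma reading_uniq i k : uniq (reading i k).
Proof.
elim: k i => [|k IH] i //; rewrite /reading /= cat_uniq -/(reading i.+1 k) IH andbT.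
rewrite map_inj_uniq ?rev_uniq ?iota_uniq //=; last by move=> ? ? [].
by apply/hasPn => c; rewrite mem_reading => h; apply/negP => /mapP[j _ e]; move: h; rewrite e /=; lia.
Qed.

Lemma row_sortedP g r : reflect
  (forall j j', part mu r < j -> j < j' -> j' <= part lam r -> g (r, j) <= g (r, j'))
  (sorted geq (map g (row_cells r))).
Proof.
rewrite /row_cells -map_comp map_rev rev_sorted.
have tr : transitive (fun y x : nat => x >= y) by move=> a b c; apply: leq_trans.
set s := map _ _.
have nth_s k : k < part lam r - part mu r -> nth 0 s k = g (r, (part mu r).+1 + k).
  by move=> lt; rewrite (nth_map 0) ?size_iota // nth_iota.
have sz : size s = part lam r - part mu r by rewrite size_map size_iota.
apply: (iffP idP) => [srt j j' h1 h2 h3|h].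
  have := @sorted_ltn_nth _ _ tr 0 _ srt (j - (part mu r).+1) (j' - (part mu r).+1).
  rewrite !inE sz !nth_s; try lia.
  rewrite !subnKC //; try lia; apply; lia.
apply/(sortedP 0) => k; rewrite sz => lt; rewrite !nth_s; try lia.
apply: h; lia.
Qed.

Lemma satisfies_rows g i k : 1 <= i -> i + k <= l.+1 ->
  satisfies (conds (rows i k)) (map g (reading i k)) <->
  (forall r, i <= r < i + k -> sorted geq (map g (row_cells r))) /\
  (forall r, i <= r -> r.+1 < i + k -> overlap r ->
     g (r, (part mu r).+1) < g (r.+1, part lam r.+1)).
Proof.
elim: k i => [|k IH] i i1 ik; first by split=> // _; split=> r; lia.
have szr r : 1 <= r <= l -> size (map g (row_cells r)) = (part lam r - part mu r).-1.+1.
  by move=> h; rewrite !size_map size_rev size_iota; have := row_ge2 h; lia.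
have split_row r : 1 <= r <= l -> exists s,
    map g (row_cells r) = rcons s (g (r, (part mu r).+1)).
  move=> h; have := row_ge2 h => h2; rewrite /row_cells.
  have -> : part lam r - part mu r = (part lam r - part mu r).-1.+1 by lia.
  by rewrite /= rev_cons map_rcons map_rcons; eexists.
have head_row r : 1 <= r <= l -> exists s,
    map g (row_cells r) = g (r, part lam r) :: s.
  move=> h; have := row_ge2 h => h2; rewrite /row_cells.
  have -> : part lam r - part mu r = (part lam r - part mu r).-1 + 1 by lia.
  rewrite iotaD rev_cat /= (_ : _ + _ = part lam r); last by lia.
  by eexists.
have hi : 1 <= i <= l by lia.
case: k IH ik => [|k] IH ik.
  rewrite /rows /reading /= !cats0 satisfies_nseq ?szr //.
  split=> [h|[h _]]; last by apply: h; lia.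
  split=> r; last by lia.
  by move=> hr; have -> : r = i by lia.
have {}IH := IH i.+1 isT ltac:(lia).
rewrite /reading [iota i _]/= map_cons [flatten _]/= map_cat -/(reading i.+1 k.+1).
have hi1 : 1 <= i.+1 <= l by lia.
have [s es] := split_row i hi; have [s' es'] := head_row i.+1 hi1.
have hd : head 0 (map g (reading i.+1 k.+1)) = g (i.+1, part lam i.+1).
  by rewrite /reading /= map_cat es'.
have sz0 : 0 < size (map g (reading i.+1 k.+1)).
  by rewrite /reading /= map_cat es'.
have lst : last 0 (map g (row_cells i)) = g (i, (part mu i).+1) by rewrite es last_rcons.
rewrite [conds _]/= -/(rows i.+1 k.+1) -[X in _ :: X]/(conds (rows i.+1 k.+1)).
rewrite satisfies_cat ?szr // lst hd.
split=> [/and3P[h1 h2 /IH[h3 h4]]|[h1 h2]].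
  split=> [r hr|r hr1 hr2 hr3].
    by case: (eqVneq r i) => [->|ne] //; apply: h3; lia.
  by case: (eqVneq r i) => [e|ne]; [move: h2; rewrite -e hr3 | apply: h4 => //; lia].
apply/and3P; split; first by apply: h1; lia.
  by case: ifP => // ov; apply: h2 => //; lia.
by apply/IH; split=> r; [move=> hr; apply: h1; lia | move=> ? ? ?; apply: h2 => //; lia].
Qed.

Lemma ssyt_satisfies n (T : {ffun seq_sub (diagram lam mu) -> 'I_n}) :
  is_ssyt T = satisfies (conds (rows 1 l)) [seq filling T c | c <- reading 1 l].
Proof.
have cellE i j (h : (i, j) \in diagram lam mu) : filling T (i, j) = T (SeqSub h).
  exact: (fillingE T (SeqSub h)).
apply/ssytP/idP => [[hr hc]|/(satisfies_rows _ (leqnn 1) (leqnn _))[hr hc]].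
  apply/(satisfies_rows _ (leqnn 1) (leqnn _)).
  split=> [r hr1|r r1 rl ov].
    apply/row_sortedP => j j' h1 h2 h3.
    have h : (r, j) \in diagram lam mu by rewrite mem_diagram; lia.
    have h' : (r, j') \in diagram lam mu by rewrite mem_diagram; lia.
    by rewrite !cellE; apply: hr.
  have e : part lam r.+1 = (part mu r).+1 by have := row_next r1; rewrite /overlap in ov; lia.
  have [g1 g2] : part mu r + 2 <= part lam r /\ part mu r.+1 + 2 <= part lam r.+1.
    by split; apply: row_ge2; lia.
  have h : (r, (part mu r).+1) \in diagram lam mu by rewrite mem_diagram; lia.
  have h' : (r.+1, part lam r.+1) \in diagram lam mu by rewrite mem_diagram; lia.
  by rewrite !cellE; apply: hc => /=.
split=> -[[r j] h] [[r' j'] h'] /= e lt; subst.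
  have hl : 1 <= r' <= l.
    move: h'; rewrite mem_diagram /part; case: (ltnP r'.-1 l) => [|le]; first by lia.
    by rewrite (nth_default 0 le); lia.
  rewrite -!cellE; apply: (row_sortedP _ _ (hr r' _)); [lia | |lia | ];
  by move: h h'; rewrite !mem_diagram; lia.
have hh := h; have hh' := h'; rewrite !mem_diagram in hh hh'.
have hl : r' <= l.
  by move: hh'; rewrite /part; case: (ltnP r'.-1 l) => [|le]; [lia | rewrite (nth_default 0 le); lia].
have le1 : part lam r' <= part lam r.+1 by apply: part_anti => //; lia.
have := @row_next r; have := @row_ge2 r.+1; have := @row_next r.+1.
(* Row [r.+1] has at least two cells and shares at most its last column with row [r], so all later
   rows end to the left of row [r]. *)
have er : r' = r.+1.
  apply/eqP; rewrite eqn_leq lt andbT leqNgt; apply/negP => lt2.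
  have : part lam r' <= part lam r.+2 by apply: part_anti => //; lia.
  by have := @row_next r; have := @row_ge2 r.+1; have := @row_next r.+1; lia.
subst r' => h1 h2 h3.
have ov : overlap r by rewrite /overlap; lia.
have := hc r; rewrite -!cellE.
have -> : j' = (part mu r).+1 by lia.
have -> : part lam r.+1 = (part mu r).+1 by lia.
by apply => //; lia.
Qed.

Lemma size_conds i k : 1 <= i -> i + k <= l.+1 -> 0 < k -> (size (conds (rows i k))).+1 = size (reading i k).
Proof.
elim: k i => // k IH i i1 ik _.
have -> : size (reading i k.+1) = (part lam i - part mu i) + size (reading i.+1 k).
  by rewrite /reading /= size_cat size_map size_rev size_iota.
have := @row_ge2 i; case: k IH ik => [|k] IH ik.
  by rewrite [conds _]/= cats0 size_nseq /reading /=; lia.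
have := IH i.+1 isT ltac:(lia) isT.
have -> : conds (rows i k.+2) = nseq (part lam i - part mu i).-1 Weak
    ++ (if overlap i then Strict else Free) :: conds (rows i.+1 k.+1) by [].
have szc y (s : seq adjacency) : size (y :: s) = (size s).+1 by [].
by rewrite size_cat size_nseq szc; lia.
Qed.

Lemma skew_schurE n : skew_schur n lam mu = ribbon_words (var_at n) n (rows 1 l).
Proof.
rewrite /skew_schur.
have eqD : diagram lam mu =i reading 1 l.
  move=> [i j]; rewrite mem_diagram mem_reading /=.
  apply/andP/andP => -[h1 h2]; split=> //; last by case/andP: h1.
  rewrite h1 add1n ltnS leqNgt; apply/negP => lt.
  by move: h2; rewrite /part (nth_default 0 (_ : size lam <= i.-1)); lia.
rewrite (@sum_word n _ _ (reading_uniq 1 l) eqD (@is_ssyt _ _) (satisfies (conds (rows 1 l)))); last exact: ssyt_satisfies.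
case: (posnP l) => [e0|l0].
  rewrite e0 /= /ribbon_words (big_pred1 [tuple]) ?big_nil // => t.
  by rewrite [t]tuple0; apply/esym/eqP.
have := size_conds (leqnn 1) (leqnn l.+1) l0.
have szr : size (rows 1 l) = l by rewrite size_map size_iota.
rewrite /ribbon_words; case: (rows 1 l) szr => [e|p q]; first by exfalso; move: e l0 => /=; lia.
by move=> _ sz; rewrite words_tuple -sz.
Qed.

End Ribbon.

(** * The Schur expansion of a ribbon *)

(* [pnu / nu] is the strip removed before; [pb] requires a descent between it and
   the next strip. *)
Fixpoint chain_count (L : seq (nat * bool)) (pb : bool) (pnu nu : seq nat) : nat :=
  if L is (a, b) :: L' then
    \sum_(nu1 <- partitions (sumn nu - a) | [&& a <= sumn nu, hstrip nu nu1 & pb ==> desc nu1 nu pnu])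
       chain_count L' b nu nu1
  else nu == [::].

Lemma chain_count_false L p nu : chain_count L false p nu = chain_count L false [::] nu.
Proof. by case: L => [|[a b] L]. Qed.

Lemma sumn_lt_exists nu nu1 K : (forall i, nth 0 nu1 i <= nth 0 nu i) -> size nu <= K -> size nu1 <= K ->
  sumn nu1 < sumn nu -> exists k, nth 0 nu1 k < nth 0 nu k.
Proof.
move=> le s1 s2 lt; case: (boolP [exists k : 'I_K, nth 0 nu1 k < nth 0 nu k]) => [/existsP[k hk]|].
  by exists k.
move/existsPn => h; move: lt; rewrite -(sumn_nth s1) -(sumn_nth s2) ltnNge => /negP[].
by apply: leq_sum => i _; rewrite leqNgt h.
Qed.

Lemma nondescP nu2 nu1 nu i j : ~~ desc nu2 nu1 nu -> i < j -> nth 0 nu2 i < nth 0 nu1 i ->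
  nth 0 nu j <= nth 0 nu1 j.
Proof. by move=> nd ij h; rewrite leqNgt; apply: contra nd => h'; apply/descP; exists i, j. Qed.

(** Whether the strip removed before makes a descent depends only on the topmost row of the next
    strip. Without a descent between [nu / nu1] and [nu1 / nu2], the topmost cell of their union
    lies in the nonempty strip [nu / nu1]. *)
Lemma desc_first nu2 nu1 nu pnu : hstrip nu nu1 -> hstrip nu1 nu2 -> ~~ desc nu2 nu1 nu ->
  sumn nu1 < sumn nu -> desc nu1 nu pnu = desc nu2 nu pnu.
Proof.
move=> /hstripP h1 /hstripP h2 nd lt.
have [k hk] : exists k, nth 0 nu1 k < nth 0 nu k.
  apply: (@sumn_lt_exists _ _ (size nu + size nu1)) => [i|||]; rewrite ?leq_addr ?leq_addl //.
  by case/andP: (h1 i).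
apply/descP/descP => -[i [j [ij l1 l2]]].
  by exists i, j; split=> //; have := h2 i; lia.
case: (ltnP (nth 0 nu1 i) (nth 0 nu i)) => h; first by exists i, j.
exists k, j; split=> //; apply: leq_ltn_trans ij; rewrite leqNgt; apply/negP => ik.
by have := nondescP nd ik; lia.
Qed.

(** Dual to [desc_first]: the lowest row of the union decides, and it belongs to [nu1 / nu2]. *)
Lemma desc_last nu3 nu2 nu1 nu : hstrip nu nu1 -> hstrip nu1 nu2 -> ~~ desc nu2 nu1 nu ->
  sumn nu2 < sumn nu1 -> desc nu3 nu2 nu1 = desc nu3 nu2 nu.
Proof.
move=> /hstripP h1 /hstripP h2 nd lt.
have [k hk] : exists k, nth 0 nu2 k < nth 0 nu1 k.
  apply: (@sumn_lt_exists _ _ (size nu1 + size nu2)) => [i|||]; rewrite ?leq_addr ?leq_addl //.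
  by case/andP: (h2 i).
apply/descP/descP => -[i [j [ij l1 l2]]].
  by exists i, j; split=> //; have := h1 j; lia.
case: (ltnP (nth 0 nu2 j) (nth 0 nu1 j)) => h; first by exists i, j.
exists i, k; split=> //; apply: leq_trans ij _; rewrite leqNgt; apply/negP => kj.
by have := nondescP nd kj hk; lia.
Qed.

Section Merge.
Variables (nu nu2 : seq nat) (a a' : nat).
Hypotheses (pn : is_partition nu) (pn2 : is_partition nu2).
Hypothesis (sz : sumn nu = sumn nu2 + a' + a).

Let good nu1 := [&& hstrip nu nu1, hstrip nu1 nu2 & ~~ desc nu2 nu1 nu].
Let d i := nth 0 nu i - nth 0 nu2 i.

(** If [nu1 / nu2] has a cell in row [i], then [nu / nu1] has none in row [i.+1], so [nu] and [nu1]
    agree there; otherwise [nu1] and [nu2] agree in row [i]. In both cases one of the two strips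
    gives the interlacing. *)
Lemma good_hstrip nu1 : good nu1 -> hstrip nu nu2.
Proof.
case/and3P=> /hstripP h1 /hstripP h2 nd; apply/hstripP => i.
have := h1 i; have := h2 i; have := h1 i.+1; have := nondescP nd (leqnn i.+1).
case: (ltnP (nth 0 nu2 i) (nth 0 nu1 i)) => [_ /(_ isT)|]; lia.
Qed.

(** Without a descent, [nu / nu1] takes the cells of [nu / nu2] from the top: once a row keeps a
    cell for [nu1 / nu2], no later row contributes. The forced prefix sums make [nu1] unique. *)
Lemma good_prefix nu1 k : is_partition nu1 -> sumn nu1 = sumn nu2 + a' -> good nu1 ->
  \sum_(i < k) (nth 0 nu i - nth 0 nu1 i) = minn a (\sum_(i < k) d i).
Proof.
move=> p1 s1 /and3P[/hstripP h1 /hstripP h2 nd].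
set K := k + size nu + size nu1.
have tot : \sum_(i < K) (nth 0 nu i - nth 0 nu1 i) = a.
  rewrite sumnB => [|i _]; last by case/andP: (h1 i).
  by rewrite !sumn_nth ?sz ?s1 /K; lia.
have le_tot : \sum_(i < k) (nth 0 nu i - nth 0 nu1 i) <= a.
  by rewrite -tot (big_ord_widen K (fun i => nth 0 nu i - nth 0 nu1 i)) /K ?big_mkcond ?leq_sum // => [i _|]; [case: ifP | lia].
have le_d : \sum_(i < k) (nth 0 nu i - nth 0 nu1 i) <= \sum_(i < k) d i.
  by apply: leq_sum => i _; rewrite /d; have := h2 i; lia.
case: (boolP [exists i : 'I_k, nth 0 nu2 i < nth 0 nu1 i]) => [/existsP[i hi]|/existsPn h].
  suff : \sum_(i < k) (nth 0 nu i - nth 0 nu1 i) = a by lia.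
  rewrite -tot (big_ord_widen K (fun i => nth 0 nu i - nth 0 nu1 i)) /K; last by lia.
  rewrite big_mkcond; apply: eq_bigr => j _; case: ltnP => // le.
  by have := nondescP nd (leq_trans (ltn_ord i) le) hi; lia.
suff : \sum_(i < k) (nth 0 nu i - nth 0 nu1 i) = \sum_(i < k) d i by lia.
by apply: eq_bigr => i _; rewrite /d; have := h i; have := h2 i; rewrite -leqNgt; lia.
Qed.

Definition mid i := nth 0 nu i - topfill d a i.

Lemma good_exists : hstrip nu nu2 ->
  exists nu1, [/\ is_partition nu1, sumn nu1 = sumn nu2 + a' & good nu1].
Proof.
move/hstripP=> h; set K := size nu + size nu2.
have tf_le i : topfill d a i <= d i by exact: geq_minl.
have dE i : d i + nth 0 nu2 i = nth 0 nu i by rewrite /d; have := h i; lia.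
have fd i : mid i.+1 <= mid i.
  by rewrite /mid; have := tf_le i; have := h i; have := dE i; lia.
have f0 : mid K = 0 by rewrite /mid nth_default // /K leq_addr.
have [p1 n1] := seq_ofP fd f0.
exists (seq_of mid K); split=> //.
  rewrite sumn_seq_of //.
  have e : \sum_(i < K) mid i + \sum_(i < K) topfill d a i = \sum_(i < K) nth 0 nu i.
    by rewrite -big_split /=; apply: eq_bigr => i _; rewrite /mid; have := tf_le i; have := dE i; lia.
  have ed : \sum_(i < K) d i + \sum_(i < K) nth 0 nu2 i = \sum_(i < K) nth 0 nu i.
    by rewrite -big_split /=; apply: eq_bigr => i _; rewrite dE.
  move: e ed; rewrite sum_topfill !sumn_nth ?sz /K ?leq_addr ?leq_addl //; lia.
apply/and3P; split.
- by apply/hstripP => i; rewrite n1 /mid; have := tf_le i; have := dE i; have := h i; lia.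
- apply/hstripP => i; rewrite !n1 /mid.
  by have := tf_le i; have := dE i; have := h i; have := tf_le i.+1; have := dE i.+1; lia.
apply/descP => -[i [j [ij]]]; rewrite !n1 /mid => h1 h2.
have lt : topfill d a i < d i by have := dE i; lia.
have gt0 : 0 < topfill d a j by lia.
have : \sum_(k < i.+1) d k <= \sum_(k < j) d k.
  by rewrite (big_ord_widen j d ij) big_mkcond leq_sum // => k _; case: ifP.
move: lt gt0; rewrite big_ord_recr /= /topfill; clear.
by move: (\sum_(k < i) d k) (\sum_(k < j) d k) => s1 s2; lia.
Qed.

Lemma merge_count : count good (partitions (sumn nu2 + a')) = hstrip nu nu2.
Proof.
case: (boolP (hstrip nu nu2)) => h; last first.
  rewrite (eq_count (a2 := pred0)) ?count_pred0 // => nu1; apply/negbTE.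
  by apply: contra h; apply: good_hstrip.
have [w [pw sw gw]] := good_exists h.
rewrite (eq_in_count (a2 := pred1 w)); last first.
  move=> nu1; rewrite mem_partitions => /andP[p1 /eqP s1]; apply/idP/eqP => [g1|->] //.
  apply: partition_ext => // i.
  have := good_prefix i p1 s1 g1; have := good_prefix i.+1 p1 s1 g1.
  rewrite -(good_prefix i pw sw gw) -(good_prefix i.+1 pw sw gw) !big_ord_recr /=.
  case/and3P: g1 => /hstripP/(_ i) + _ _; case/and3P: gw => /hstripP/(_ i) + _ _; lia.
by rewrite count_uniq_mem ?partitions_uniq // mem_partitions pw sw eqxx.
Qed.

End Merge.

(** The chains at a free junction either have a descent there or not. Without one, the two strips
    form a single strip, which by [merge_count] splits back in exactly one way. *)
Lemma chain_count_merge a a' b L pb pnu nu : 0 < a -> 0 < a' -> is_partition nu ->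
  chain_count ((a, false) :: (a', b) :: L) pb pnu nu =
  chain_count ((a + a', b) :: L) pb pnu nu + chain_count ((a, true) :: (a', b) :: L) pb pnu nu.
Proof.
move=> a0 a0' pn /=.
case: (leqP a (sumn nu)) => [lea|lta]; last first.
  by rewrite !big_pred0 // => nu1; rewrite leqNgt (leq_trans lta) ?leq_addr.
have -> : \sum_(nu1 <- partitions (sumn nu - a) | [&& true, hstrip nu nu1 & pb ==> desc nu1 nu pnu])
   \sum_(nu2 <- partitions (sumn nu1 - a') | [&& a' <= sumn nu1, hstrip nu1 nu2 & false ==> desc nu2 nu1 nu])
      chain_count L b nu1 nu2 =
  \sum_(nu1 <- partitions (sumn nu - a) | [&& true, hstrip nu nu1 & pb ==> desc nu1 nu pnu])
   \sum_(nu2 <- partitions (sumn nu1 - a') | [&& a' <= sumn nu1, hstrip nu1 nu2 & ~~ desc nu2 nu1 nu])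
      chain_count L b nu1 nu2 +
  \sum_(nu1 <- partitions (sumn nu - a) | [&& true, hstrip nu nu1 & pb ==> desc nu1 nu pnu])
   \sum_(nu2 <- partitions (sumn nu1 - a') | [&& a' <= sumn nu1, hstrip nu1 nu2 & true ==> desc nu2 nu1 nu])
      chain_count L b nu1 nu2.
  rewrite -big_split /=; apply: eq_bigr => nu1 _.
  rewrite (bigID (fun nu2 => ~~ desc nu2 nu1 nu)) /=; congr (_ + _); apply: eq_bigl => nu2.
    by rewrite andbT andbA.
  by rewrite negbK andbT andbA.
congr (_ + _).
case: (leqP (a + a') (sumn nu)) => [le|lt]; last first.
  rewrite [RHS]big_pred0 // big1_seq // => nu1 /andP[_]; rewrite mem_partitions => /andP[_ /eqP s1].
  by rewrite big_pred0 // => nu2; rewrite s1 leqNgt (_ : sumn nu - a < a') //; lia.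
(* [desc_first] and [desc_last] rewrite the neighbouring descent conditions without [nu1], so that
   the sum over [nu1] becomes a pure count. *)
transitivity (\sum_(nu1 <- partitions (sumn nu - a))
   \sum_(nu2 <- partitions (sumn nu - (a + a')) | [&& hstrip nu nu1, hstrip nu1 nu2 & ~~ desc nu2 nu1 nu])
     if pb ==> desc nu2 nu pnu then chain_count L b nu nu2 else 0).
  rewrite big_mkcond; apply: eq_big_seq => nu1; rewrite mem_partitions => /andP[p1 /eqP s1].
  have les : a' <= sumn nu1 by lia.
  have es : sumn nu1 - a' = sumn nu - (a + a') by lia.
  rewrite es les /=.
  transitivity (\sum_(nu2 <- partitions (sumn nu - (a + a')) | [&& hstrip nu nu1, hstrip nu1 nu2 & ~~ desc nu2 nu1 nu])
     if pb ==> desc nu1 nu pnu then chain_count L b nu1 nu2 else 0).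
    case: (hstrip nu nu1) => /=; last by rewrite big_pred0.
    by case: ifP => // _; rewrite big1.
  rewrite big_seq_cond [RHS]big_seq_cond; apply: eq_bigr => nu2.
  rewrite mem_partitions => /andP[/andP[p2 /eqP s2] g].
  have sz : sumn nu = sumn nu2 + a' + a by lia.
  have s1' : sumn nu1 = sumn nu2 + a' by lia.
  case/and3P: g => g1 g2 g3.
  rewrite (desc_first _ g1 g2 g3); last by lia.
  congr (if _ then _ else _).
  case: (L) => [|[c e] L'] //=; apply: eq_bigl => nu3; congr [&& _, _ & _ ==> _].
  by apply: (desc_last _ g1 g2 g3); lia.
rewrite (exchange_big_dep predT) //= [RHS]big_mkcond; apply: eq_big_seq => nu2.
rewrite mem_partitions => /andP[p2 /eqP s2].
rewrite big_const_seq iter_addn_0.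
have sz : sumn nu = sumn nu2 + a' + a by lia.
have -> : sumn nu - a = sumn nu2 + a' by lia.
rewrite (merge_count pn p2 sz).
by case: (hstrip nu nu2) => /=; rewrite ?muln1 ?muln0.
Qed.

Lemma chain_count_merge_cat L1 a a' b L pb pnu nu : 0 < a -> 0 < a' -> is_partition nu ->
  chain_count (L1 ++ (a, false) :: (a', b) :: L) pb pnu nu =
  chain_count (L1 ++ (a + a', b) :: L) pb pnu nu + chain_count (L1 ++ (a, true) :: (a', b) :: L) pb pnu nu.
Proof.
move=> a0 a0'; elim: L1 pb pnu nu => [|[c e] L1 IH] pb pnu nu pn; first exact: chain_count_merge.
rewrite [LHS]/= [in RHS]/= -big_split /= big_seq_cond [RHS]big_seq_cond; apply: eq_bigr => nu1.
by rewrite mem_partitions => /andP[/andP[p1 _] _]; apply: IH.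
Qed.

Local Open Scope ring_scope.

Section Expansion.
Variables (R : comRingType) (x : nat -> R) (n : nat).

Definition expands (L : seq (nat * bool)) :=
  ribbon_words x n L = \sum_(nu <- partitions (sumn (unzip1 L))) (chain_count L false [::] nu)%:R * schur_poly x n nu.

Lemma schur_poly_nil m : schur_poly x m [::] = 1.
Proof.
elim: m => [|m IH] //=.
rewrite big_mkcond (perm_big [:: [::]]) /=; first by rewrite big_seq1 IH mulr1.
apply: uniq_perm => // [|s]; first exact: partitions_upto_uniq.
rewrite mem_partitions_upto inE; apply/andP/eqP => [[ps /= s0]|->] //.
by apply: size0nil; have := size_partition_le ps; lia.
Qed.

(** The three lists of rows give words of the same length and differ in one condition, at the
    junction: the [(a + a').-1] weak conditions of the merged row are those of both rows and one
    more. *)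
Lemma conds_cat L1 a a' b L : (0 < a)%N -> (0 < a')%N -> exists c1 c2,
  (forall b0, conds (L1 ++ (a, b0) :: (a', b) :: L) = c1 ++ (if b0 then Strict else Free) :: c2) /\
  conds (L1 ++ ((a + a')%N, b) :: L) = c1 ++ Weak :: c2.
Proof.
move=> a0 a0'; elim: L1 => [|[c e] L1 [c1 [c2 [h1 h2]]]].
  exists (nseq a.-1 Weak), (conds ((a', b) :: L)); split=> //=.
  have -> : ((a + a').-1 = a.-1 + (a'.-1).+1)%N by lia.
  by rewrite nseqD -catA.
exists (nseq c.-1 Weak ++ (if e then Strict else Free) :: c1), c2.
have cE M : (0 < size M)%N -> conds ((c, e) :: M) = nseq c.-1 Weak ++ (if e then Strict else Free) :: conds M.
  by case: M.
by split=> [b0|]; rewrite cat_cons cE ?size_cat ?addnS // ?h1 ?h2 -catA.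
Qed.

Lemma ribbon_words_merge L1 a a' b L : (0 < a)%N -> (0 < a')%N ->
  ribbon_words x n (L1 ++ (a, false) :: (a', b) :: L) =
  ribbon_words x n (L1 ++ ((a + a')%N, b) :: L) + ribbon_words x n (L1 ++ (a, true) :: (a', b) :: L).
Proof.
move=> a0 a0'; have [c1 [c2 [h1 h2]]] := conds_cat L1 b L a0 a0'.
have rwE M : (0 < size M)%N -> ribbon_words x n M = words x n (conds M) by case: M.
by rewrite !rwE ?size_cat ?addnS // !h1 h2 words_split.
Qed.

(** Without overlaps the words form a product of complete homogeneous polynomials, expanded by one
    use of [pieri] per row. *)
Lemma expands_free L : all (fun p => 0 < p.1)%N L -> all (fun p => ~~ p.2) L -> expands L.
Proof.
elim: L => [|[a b] L IH] /=.
  move=> _ _; rewrite /expands /= (perm_big [:: [::]]) /=; first by rewrite big_seq1 schur_poly_nil mulr1.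
  apply: uniq_perm; rewrite ?partitions_uniq // => s.
  rewrite mem_partitions inE; apply/andP/eqP => [[ps /eqP /= s0]|->] //.
  by apply: size0nil; have := size_partition_le ps; lia.
case/andP=> a0 aL /andP[/negbTE -> fL]; have {}IH := IH aL fL.
have -> : expands ((a, false) :: L) = (complete_poly x n a * ribbon_words x n L =
    \sum_(nu <- partitions (sumn (unzip1 L) + a)) (chain_count ((a, false) :: L) false [::] nu)%:R * schur_poly x n nu).
  rewrite /expands /= addnC; congr (_ = _).
  case: (L) => [|p L'].
    by rewrite cats0 /ribbon_words mulr1 words_run prednK.
  by rewrite words_cat words_run prednK.
rewrite IH mulr_sumr.
transitivity (\sum_(nu1 <- partitions (sumn (unzip1 L)))
   \sum_(nu <- partitions (sumn (unzip1 L) + a) | hstrip nu nu1) (chain_count L false [::] nu1)%:R * schur_poly x n nu).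
  apply: eq_big_seq => nu1; rewrite mem_partitions => /andP[p1 /eqP s1].
  by rewrite mulrCA pieri // s1 mulr_sumr.
rewrite (exchange_big_dep predT) //=; apply: eq_big_seq => nu.
rewrite mem_partitions => /andP[pn /eqP sn].
rewrite sn addnK leq_addl /= -mulr_suml natr_sum; congr (_ * _).
by apply: eq_big => [nu1|nu1 _]; rewrite ?andbT // chain_count_false.
Qed.

(** Induction on the number of overlaps: the merge identities of words and of chains are solved for
    the list with an overlap, and the other two lists have one overlap less. The last flag is false,
    so an overlapping row has a successor to merge with. *)
Lemma expandsP L : all (fun p => 0 < p.1)%N L -> ~~ (last (0%N, false) L).2 -> expands L.
Proof.
have [k] := ubnP (count snd L); elim: k L => // k IH L; rewrite ltnS => lek pL lL.
case: (boolP (has snd L)) => [hL|]; last first.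
  by move/hasPn => h; apply: expands_free => //; apply/allP => p /h.
have : exists L1 a L2, L = L1 ++ (a, true) :: L2.
  elim: L hL {lek pL lL} => //= -[a [|]] L IHL /=; first by exists [::], a, L.
  by case/IHL => L1 [a' [L2 ->]]; exists ((a, false) :: L1), a', L2.
case=> L1 [a [[|[a' b] L2] eL]].
  by move: lL; rewrite eL last_cat.
move: pL; rewrite eL all_cat /= => /and4P[pL1 a0 a0' pL2].
have ef : expands (L1 ++ (a, false) :: (a', b) :: L2).
  apply: IH.
  - by move: lek; rewrite eL !count_cat /=; lia.
  - by rewrite all_cat /= pL1 a0 a0'.
  - by move: lL; rewrite eL !last_cat.
have em : expands (L1 ++ ((a + a')%N, b) :: L2).
  apply: IH.
  - by move: lek; rewrite eL !count_cat /=; lia.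
  - by rewrite all_cat /= pL1 pL2 addn_gt0 a0.
  - by move: lL; rewrite eL !last_cat /=; case: (L2).
have s1 : sumn (unzip1 (L1 ++ (a, false) :: (a', b) :: L2)) = sumn (unzip1 (L1 ++ (a, true) :: (a', b) :: L2)).
  by rewrite /unzip1 !map_cat.
have s2 : sumn (unzip1 (L1 ++ ((a + a')%N, b) :: L2)) = sumn (unzip1 (L1 ++ (a, true) :: (a', b) :: L2)).
  by rewrite /unzip1 !map_cat !sumn_cat /= -addnA.
rewrite /expands; have := ribbon_words_merge L1 b L2 a0 a0'; rewrite ef em s1 s2 => /eqP; rewrite addrC -subr_eq => /eqP <-.
rewrite -sumrB; apply: eq_big_seq => nu; rewrite mem_partitions => /andP[pn _].
by rewrite -mulrBl chain_count_merge_cat // natrD addrC addKr.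
Qed.

End Expansion.

Local Close Scope ring_scope.

(** * Linear independence of Schur polynomials *)

Lemma count_rows_le nu j : count (fun c => c.1 <= j) (diagram nu [::]) = sumn (take j nu).
Proof.
rewrite -size_diagram0 -size_filter; apply: perm_size; apply: uniq_perm.
- by rewrite filter_uniq ?diagram_uniq.
- exact: diagram_uniq.
move=> [a b]; rewrite mem_filter !mem_diagram /part !nth_nil /=.
case: a => [|a] /=; first by rewrite ?andbF.
case: (ltnP a j) => h; first by rewrite nth_take.
have sz : size (take j nu) <= a by rewrite size_take; case: ifP; lia.
by rewrite (nth_default 0 sz) /=; case: b.
Qed.

Lemma sumn_takeS (s : seq nat) i : sumn (take i.+1 s) = sumn (take i s) + nth 0 s i.
Proof. by rewrite !sumn_take_nth big_ord_recr. Qed.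

Lemma sum_seq_sub_count (D : seq (nat * nat)) (P : pred (nat * nat)) : uniq D ->
  \sum_(x : seq_sub D) P (val x) = count P D.
Proof.
move=> uD; rewrite (big_seq_sub _ (fun c => P c : nat)) // -sum1_count [RHS]big_mkcond.
by apply: eq_bigr => c _; case: (P c).
Qed.

Section Leading.
Variables (n : nat) (nu : seq nat).
Hypothesis pn : is_partition nu.
Notation D := (diagram nu [::]).

Definition wt (T : {ffun seq_sub D -> 'I_n}) : 'X_{1..n} := (\sum_x U_(T x))%MM.
Definition mon (ka : seq nat) : 'X_{1..n} := [multinom nth 0 ka i | i < n].

Lemma wtE T i : wt T i = \sum_x (T x == i).
Proof. by rewrite /wt mnm_sumE; apply: eq_bigr => x _; rewrite mnmE. Qed.

Lemma mcoeff_schur ka :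
  ((schur n nu)@_(mon ka) = (\sum_(T : {ffun seq_sub D -> 'I_n} | is_ssyt T) (wt T == mon ka))%:R)%R.
Proof.
rewrite /schur /skew_schur raddf_sum natr_sum /=; apply: eq_bigr => T _.
by rewrite mprodXE mcoeffX.
Qed.

Lemma ssyt_entry_ge (T : {ffun seq_sub D -> 'I_n}) x : is_ssyt T -> (val x).1 <= (T x).+1.
Proof.
case/ssytP=> _ hc; have [i] := ubnP (val x).1; elim: i x => // i IH x.
have [a [b e]] := cell_ge1 (valP x); rewrite e /= => lt.
case: a e lt => // a e lt.
have h : (a.+1, b.+1) \in D.
  have := valP x; rewrite e !mem_diagram0 => h; apply: leq_trans h _; exact: is_partition_nth.
have h1 : T (SeqSub h) < T x by apply: hc; rewrite e.
have : a.+1 <= (T (SeqSub h)).+1 by apply: (IH (SeqSub h)); rewrite /=; lia.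
lia.
Qed.

(** Columns increase strictly, so an entry is at least its row index counted from 0; hence all
    entries below [j] lie in the first [j] rows. *)
Lemma ssyt_dominance (T : {ffun seq_sub D -> 'I_n}) ka j : size ka <= n -> is_ssyt T -> wt T = mon ka ->
  sumn (take j ka) <= sumn (take j nu).
Proof.
move=> sk sT eT.
have -> : sumn (take j ka) = \sum_(i < n | i < j) nth 0 ka i.
  rewrite sumn_take_nth; case: (leqP j n) => [le|/ltnW le].
    by rewrite (big_ord_widen n (fun i => nth 0 ka i) le).
  rewrite -sumn_take_nth take_oversize ?(leq_trans sk) // -(sumn_nth sk).
  by apply: eq_bigl => i; rewrite (leq_trans (ltn_ord i) le).
rewrite -count_rows_le -sum_seq_sub_count ?diagram_uniq //.
under eq_bigr => i _.
  have -> : nth 0 ka i = wt T i by rewrite eT mnmE.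
  rewrite wtE; over.
rewrite exchange_big /=; apply: leq_sum => x _.
have ge := ssyt_entry_ge x sT.
rewrite big_mkcond (bigD1 (T x)) //= eqxx big1 => [|i ne]; last first.
  by rewrite eq_sym (negbTE ne); case: ifP.
case: ifP => [lt|_] //; rewrite addn0 lt0n eqb0 negbK.
exact: leq_trans ge lt.
Qed.

Lemma superstandard : size nu <= n -> exists2 T : {ffun seq_sub D -> 'I_n}, is_ssyt T & wt T = mon nu.
Proof.
move=> sn.
have lt (x : seq_sub D) : (val x).1.-1 < n.
  have [a [b e]] := cell_ge1 (valP x); have := valP x; rewrite e mem_diagram0 /= => h.
  apply: leq_trans sn; rewrite -is_partition_nth_gt0 //; lia.
exists [ffun x => Ordinal (lt x)].
  apply/ssytP; split=> x y; rewrite !ffunE /=; first by move=> ->.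
  by have [a [b ->]] := cell_ge1 (valP x); have [a' [b' ->]] := cell_ge1 (valP y) => /=.
apply/mnmP => i; rewrite wtE mnmE.
transitivity (\sum_(x : seq_sub D) ((val x).1 == i.+1)).
  apply: eq_bigr => x _; rewrite ffunE -val_eqE /=.
  by have [a [b ->]] := cell_ge1 (valP x).
rewrite (sum_seq_sub_count (fun c => c.1 == i.+1)) ?diagram_uniq //.
have := sumn_takeS nu i; rewrite -!count_rows_le.
have -> : count (fun c => c.1 <= i.+1) D = count (fun c => c.1 <= i) D + count (fun c => c.1 == i.+1) D.
  rewrite -count_predUI [X in _ + X](eq_count (a2 := pred0)) ?count_pred0 ?addn0.
    by apply: eq_count => c /=; lia.
  by move=> c /=; lia.
exact: addnI.
Qed.

End Leading.

(** A numerical statistic that strictly increases along dominance, so that induction over the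
    dominance order becomes induction over [nat]. *)
Definition dom_height k (nu : seq nat) := \sum_(j < k.+1) sumn (take j nu).

Lemma dom_height_lt k ka nu : is_partition ka -> is_partition nu -> sumn ka = k -> sumn nu = k ->
  (forall j, sumn (take j ka) <= sumn (take j nu)) -> nu != ka -> dom_height k ka < dom_height k nu.
Proof.
move=> pk pn sk sn dom ne; rewrite ltnNge; apply: contra ne => le.
have eqj (j : 'I_k.+1) : sumn (take j ka) = sumn (take j nu).
  apply/eqP; rewrite eqn_leq dom /= leqNgt; apply/negP => lt; move: le; apply/negP; rewrite -ltnNge.
  rewrite /dom_height (bigD1 j) //= [X in _ < X](bigD1 j) //= -addSn; apply: leq_add => //.
  by apply: leq_sum => i _; apply: dom.
have eqj' j : sumn (take j ka) = sumn (take j nu).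
  case: (ltnP j k.+1) => [lt|gt]; first exact: (eqj (Ordinal lt)).
  by rewrite !take_oversize ?sk ?sn //; [have := size_partition_le pn | have := size_partition_le pk]; lia.
apply/eqP; apply: partition_ext => // i.
by have := sumn_takeS nu i; have := sumn_takeS ka i; rewrite !eqj'; lia.
Qed.

Local Open Scope ring_scope.

(** Triangularity: the monomial of [ka] occurs in the Schur polynomial of [nu] only if [nu]
    dominates [ka], and it does occur for [nu = ka]. The induction starts from the most dominant
    partitions; [k] variables suffice because partitions of [k] have at most [k] parts. *)
Lemma schur_independent k (d : seq nat -> int) :
  \sum_(nu <- partitions k) d nu *: schur k nu = 0 ->
  forall nu, nu \in partitions k -> d nu = 0.
Proof.
move=> sum0 ka.
have bound nu : nu \in partitions k -> (dom_height k nu <= k.+1 * k)%N.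
  rewrite mem_partitions => /andP[_ /eqP sn]; rewrite /dom_height.
  rewrite -[X in (X * _)%N]card_ord -sum_nat_const; apply: leq_sum => j _.
  by rewrite -[X in (_ <= X)%N]sn -[X in (_ <= sumn X)%N](cat_take_drop j) sumn_cat leq_addr.
have [m] := ubnP (k.+1 * k - dom_height k ka)%N; elim: m ka => // m IH ka lem kin.
have := kin; rewrite mem_partitions => /andP[pk /eqP sk].
have szk : (size ka <= k)%N by rewrite -sk size_partition_le.
have := congr1 (mcoeff (mon k ka)) sum0; rewrite mcoeff0 raddf_sum /=.
rewrite (bigD1_seq ka) ?partitions_uniq //= big1_seq => [|nu]; last first.
  case/andP=> ne nin; have := nin; rewrite mem_partitions => /andP[pn /eqP sn].
  rewrite mcoeffZ mcoeff_schur //.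
  case: (boolP [exists T : {ffun seq_sub (diagram nu [::]) -> 'I_k}, is_ssyt T && (wt T == mon k ka)]).
    case/existsP=> T /andP[sT /eqP eT].
    have lt := dom_height_lt pk pn sk sn (fun j => ssyt_dominance pn j szk sT eT) ne.
    by rewrite IH ?mul0r //; have := bound nu nin; lia.
  move/existsPn=> h; rewrite big1 ?mulr0 // => T sT.
  by have := h T; rewrite sT /= => /negbTE ->.
rewrite addr0 mcoeffZ mcoeff_schur // => /eqP; rewrite mulf_eq0 => /orP[/eqP //|].
have [T sT eT] := superstandard pk szk.
by rewrite pnatr_eq0 (bigD1 T) //= eT eqxx.
Qed.

Local Close Scope ring_scope.

(** * Removing one horizontal strip *)

(** Row 0 is kept apart from the crude bound by [f k] on the other rows; [f k] is added on both
    sides to avoid the factor [k - 1]. *)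
Lemma sum_antimono_ge (f : nat -> nat) k : (forall i, f i.+1 <= f i) ->
  f 0 + k * f k <= \sum_(j < k) f j + f k.
Proof.
move=> fd; elim: k => [|k IH]; first by rewrite big_ord0 mul0n addn0.
rewrite sum_recr; have := fd k => h.
have : k.+1 * f k.+1 <= k * f k + f k.+1 by rewrite mulSn; have := leq_mul (leqnn k) h; lia.
lia.
Qed.

Lemma sum_le_const (f : nat -> nat) c k : (forall j, j < k -> f j <= c) -> \sum_(j < k) f j <= k * c.
Proof.
move=> h; rewrite -[X in X * c](card_ord k) -sum_nat_const; apply: leq_sum => j _; exact: h.
Qed.

Lemma sum_ge_len (f : nat -> nat) i k : i <= k -> (forall j, i <= j < k -> 0 < f j) ->
  \sum_(j < i) f j + (k - i) <= \sum_(j < k) f j.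
Proof.
elim: k => [|k IH] le h; first by rewrite (_ : i = 0) ?big_ord0; lia.
case: (eqVneq i k.+1) => [->|ne]; first by lia.
have := IH ltac:(lia) (fun j hj => h j ltac:(lia)); have := h k; rewrite sum_recr; lia.
Qed.

Lemma sum_mono (f : nat -> nat) i k : i <= k -> \sum_(j < i) f j <= \sum_(j < k) f j.
Proof. by move=> le; rewrite (big_ord_widen k f le) big_mkcond leq_sum // => j _; case: ifP. Qed.

Section Step.
Variables (l : nat) (al A p v : nat -> nat) (bf : nat -> bool).
Hypothesis l_gt0 : 0 < l.
Hypothesis al_anti : forall i j, i <= j -> j < l -> al j <= al i.
Hypothesis al_ge2 : forall i, i < l -> 2 <= al i.
Hypothesis A_rec : forall i, i < l -> A i = al i + A i.+1.
Hypothesis A_0 : forall i, l <= i -> A i = 0.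
Hypothesis p_rec : forall i, i < l -> p i = bf i + p i.+1.
Hypothesis p_le : forall i, p i <= l - i.+1.
Hypothesis v_dec : forall i, v i.+1 <= v i.
Hypothesis v_bnd : forall i, v i + p i <= A i.
Hypothesis v_sum : \sum_(j < l) v j = A 0.
Hypothesis v_dom : forall k, k <= l -> \sum_(j < k) al j <= \sum_(j < k) v j.

Let v_anti : forall i j, i <= j -> v j <= v i := antimono_nth v_dec.

Lemma A_ge2 i : 2 * (l - i) <= A i.
Proof.
have [k] := ubnP (l - i); elim: k i => // k IH i lt.
case: (ltnP i l) => [il|le]; last by lia.
by have := IH i.+1; have := A_rec il; have := al_ge2 il; lia.
Qed.

Lemma sum_al k : k <= l -> \sum_(j < k) al j + A k = A 0.
Proof.
elim: k => [|k IH] le; first by rewrite big_ord0.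
by have := IH (ltnW le); rewrite sum_recr (A_rec le); lia.
Qed.

Lemma sum_al1 k : k < l -> \sum_(j < k) al j.+1 + A k.+1 = A 1.
Proof.
elim: k => [|k IH] le; first by rewrite big_ord0.
by have := IH (ltnW le); rewrite (sum_recr (fun j => al j.+1)) (A_rec le); lia.
Qed.

Lemma v0_ge : al 0 <= v 0.
Proof. by have := v_dom l_gt0; rewrite !big_ord1. Qed.

Lemma v_l i : l <= i -> v i = 0.
Proof. by move=> le; have := v_bnd i; have := A_0 le; lia. Qed.

Lemma last_max_row : exists2 m, v m = v 0 & v m.+1 < v 0.
Proof.
have ex : exists k, v k < v 0.
  by exists l; rewrite v_l //; have := v0_ge; have := al_ge2 l_gt0; lia.
case: (ex_minnP ex) => -[|m]; first by rewrite ltnn.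
move=> lt mn; exists m => //; apply/eqP; rewrite eqn_leq v_anti //= leqNgt; apply/negP => /mn.
by rewrite ltnn.
Qed.

Section WithMax.
Variable m0 : nat.
Hypotheses (vm0 : v m0 = v 0) (vm1 : v m0.+1 < v 0).

(* [m0] is the last longest row. Keeping [e] below [v] there makes the removed
   strip reach the last column, so the next strip that leaves the first row is a
   descent. *)
Let e j := v j - (j == m0).
Let C j := A j.+1 - p j.+1.
Let u j := minn (e j) (C j).

Let v0_ge2 : 2 <= v 0.
Proof. by have := v0_ge; have := al_ge2 l_gt0; lia. Qed.

(** Each remaining row adds at least two cells to [A i.+1], but at most one overlap to [p i.+1], and
    the last row adds none. *)
Lemma C_ge i : i.+1 < l -> l - i <= C i.
Proof. by move=> lt; have := A_ge2 i.+1; have := p_le i.+1; rewrite /C; lia. Qed.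

Lemma sum_e k : \sum_(j < k) e j + (m0 < k) = \sum_(j < k) v j.
Proof.
elim: k => [|k IH]; first by rewrite !big_ord0.
rewrite !sum_recr -IH ltnS leq_eqVlt /e eq_sym.
case: (eqVneq m0 k) => [ek|ne] /=; last by lia.
by rewrite -ek ltnn vm0; lia.
Qed.

Lemma inactive_dom k : k < l -> \sum_(j < k) al j.+1 <= \sum_(j < k) e j.
Proof.
move=> lt; have e1 := sum_e k; have e2 := sum_al1 lt; have e3 := sum_al (ltnW lt).
have d1 := v_dom (ltnW lt); have d2 := v_dom lt; have a0 := al_anti (leq0n k) lt.
have r0 := A_rec l_gt0; have rk := A_rec lt.
rewrite !sum_recr in d2.
case: (ltnP m0 k) e1 => [lmk|_] e1; rewrite ?addn0 in e1; last by lia.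
(* Only the single removed cell could spoil the claim. That would force [al] to be constant up to
   [k] and its sum over the first [k] rows to equal that of [v]; but [v k >= al 0] and [v 0 > v k]
   make the latter larger than [k * al 0]. *)
rewrite leqNgt; apply/negP => gt.
have ek : al k = al 0 by lia.
have vk : v k < v 0 by apply: leq_ltn_trans vm1; apply: v_anti.
have s1 : \sum_(j < k) v j = \sum_(j < k) al j by lia.
have s2 := sum_antimono_ge k v_dec.
have s3 : \sum_(j < k) al j <= k * al 0.
  by apply: sum_le_const => j jk; apply: al_anti => //; lia.
have s4 : k * al 0 <= k * v k by apply: leq_mul => //; lia.
lia.
Qed.

Lemma u_pos j : j.+1 < l -> 0 < v j -> 0 < u j.
Proof.
move=> lt vj; rewrite /u leq_min; apply/andP; split; last by have := C_ge lt; lia.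
by rewrite /e; case: eqP => [->|_] /=; rewrite ?vm0; lia.
Qed.

(* A row [i] is active when the bound [C i] cuts into it. Before the first active
   row the claim is [inactive_dom]; the bound [C i] is so close to the sum of all
   remaining parts that little is needed from the rows after it. *)
Lemma u_dom k : k < l -> \sum_(j < k) al j.+1 <= \sum_(j < k) u j.
Proof.
move=> lt.
have u_e j : ~~ (C j < e j) -> u j = e j by rewrite -leqNgt /u; lia.
case: (boolP [exists j : 'I_k, C j < e j]) => [/existsP[i0 hi0]|/existsPn no]; last first.
  by apply: leq_trans (inactive_dom lt) _; apply: leq_sum => j _; rewrite u_e.
have ex : exists i, (i < k) && (C i < e i) by exists i0; rewrite ltn_ord.
case: (ex_minnP ex) => i /andP[ik act] mn {i0 hi0 ex}.
have before j : j < i -> u j = e j.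
  move=> ji; apply: u_e; apply/negP => act'.
  by have := mn j; rewrite act' (ltn_trans ji ik) => /(_ isT); rewrite leqNgt ji.
have Ui : \sum_(j < i) al j.+1 <= \sum_(j < i) u j.
  apply: leq_trans (inactive_dom (ltn_trans ik lt)) _.
  by rewrite leq_eqVlt; apply/orP; left; apply/eqP/eq_bigr => j _; rewrite before.
have ui : u i = C i by rewrite /u; lia.
have Ui1 : \sum_(j < i.+1) u j = \sum_(j < i) u j + C i by rewrite sum_recr ui.
have ali := sum_al1 (ltn_trans ik lt); have alk := sum_al1 lt.
have ple := p_le i.+1; have Ci : C i + p i.+1 = A i.+1.
  by rewrite /C; have := v_bnd i.+1; lia.
have Ak := A_ge2 k.+1.
have lei : i.+1 < l by lia.
have cont x : i < x <= k -> 0 < v x.-1 -> \sum_(j < i.+1) u j + (x - i.+1) <= \sum_(j < x) u j.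
  move=> hx vx; apply: sum_ge_len; first by lia.
  by move=> j hj; apply: u_pos; [lia | apply: leq_trans vx _; apply: v_anti; lia].
(* Up to the first active row [i] the sum of [u] is at least [A 1 - p i.+1], and [A 1 - A k.+1] is
   needed. The gap is covered by one cell for each row after [i], if these are nonempty, together
   with [A k.+1 >= 2 * (l - k.+1)]. *)
case: (posnP (v k.-1)) => [vk0|vk]; last first.
  by have := cont k ltac:(lia) vk; lia.
(* A second active row [i'] has [C i' >= l - i']; with one cell for each row in between this already
   exceeds [p i.+1]. *)
case: (boolP [exists j : 'I_k, (i < j) && (C j < e j)]) => [/existsP[i' /andP[ii' act']]|/existsPn no].
  have vi' : 0 < v i' by move: act'; rewrite /e; lia.
  have lti' := ltn_ord i'.
  have := cont i'; have := C_ge (i := i') ltac:(lia).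
  have : 0 < v i'.-1 by apply: leq_trans vi' _; apply: v_anti; lia.
  have ui' : u i' = C i' by rewrite /u; lia.
  have := sum_mono u lti'; rewrite sum_recr ui'; lia.
have Uk : \sum_(j < k) u j + e i = \sum_(j < k) e j + C i.
  have split (f : nat -> nat) : \sum_(j < k) f j = f i + \sum_(j < k | j != Ordinal ik) f j.
    by rewrite (bigD1 (Ordinal ik)).
  rewrite (split u) (split e) ui.
  have -> : \sum_(j < k | j != Ordinal ik) u j = \sum_(j < k | j != Ordinal ik) e j; last by lia.
  apply: eq_bigr => j ne.
  case: (ltngtP j i) => [ji|ij|ej]; first exact: before.
    by apply: u_e; have := no j; rewrite ij.
  by case/eqP: ne; apply: val_inj.
have vz j : k.-1 <= j -> v j = 0.
  by move=> le; apply/eqP; rewrite -leqn0 -vk0 v_anti.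
have m0k : m0 < k.
  rewrite ltnNge; apply/negP => le; have := vz m0; rewrite vm0; lia.
have svk : \sum_(j < k) v j = A 0.
  rewrite -v_sum (big_ord_widen l v (ltnW lt)) big_mkcond; apply: eq_bigr => j _.
  by case: ltnP => // le; rewrite vz //; lia.
have se := sum_e k; rewrite m0k svk in se.
have r0 := A_rec l_gt0; have ri := A_rec (ltn_trans ik lt); have pri := p_rec (ltn_trans ik lt).
have vbi := v_bnd i; have a0i := al_anti (leq0n i) (ltn_trans ik lt).
(* Only row [i] is cut, and the first [k] rows contain all of [v], so the claim reduces to this
   strict inequality. The bound [v i <= al i + C i] from [v_bnd] gives it up to equality, and the
   removed cell has to supply the rest. *)
suff : e i < al 0 + A k.+1 + C i by lia.
case: (ltngtP i m0) => [im|mi|em].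
- have : v m0 <= v i.+1 by apply: v_anti.
  have := v_bnd i.+1; have := v_dec i; have := v_anti (leq0n i).
  by move: act; rewrite vm0 /e; lia.
(* Here [i > 0] and [v 0 > v i]. Equality would make the first [i.+1] rows of [v] so long that their
   sum stays within [A 0] only if [C i < p i.+1], against [C_ge]. *)
- have ei : e i = v i by rewrite /e; lia.
  rewrite ei ltnNge; apply/negP => le.
  have vi : v i = al 0 + C i by lia.
  have ai : al i = al 0 by lia.
  have v0i : v i < v 0 by apply: leq_ltn_trans vm1; apply: v_anti.
  have s1 := sum_antimono_ge i v_dec.
  have s2 : \sum_(j < i.+1) al j <= i.+1 * al 0.
    by apply: sum_le_const => j ji; apply: al_anti => //; lia.
  have s3 := sum_al (ltn_trans ik lt).
  have s4 : \sum_(j < i.+1) v j <= A 0.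
    by rewrite -svk; apply: sum_mono.
  have s5 : i * C i + i * al 0 = i * v i by rewrite vi mulnDr addnC.
  have s6 : C i <= i * C i by rewrite -[X in X <= _]mul1n leq_mul //; lia.
  have c := C_ge lei.
  rewrite !sum_recr in s2 s3 s4.
  rewrite mulSn in s2; lia.
by rewrite /e em eqxx; have := v0_ge2; rewrite -vm0 -em; lia.
Qed.

Let lo_u j : v j.+1 <= u j.
Proof.
rewrite /u leq_min; apply/andP; split; last by rewrite /C; have := v_bnd j.+1; lia.
rewrite /e; case: eqP => [->|_] /=; have := v_dec j; last by lia.
by rewrite vm0; lia.
Qed.

(** The shifted rows [v j.+1] are the least that a horizontal strip permits. They miss [v 0 - al 0]
    of the [A 1] cells, which are added as high as the caps [u] allow. *)
Definition next_row j := v j.+1 + topfill (fun i => u i - v i.+1) (v 0 - al 0) j.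

Lemma next_row_le j : next_row j <= u j.
Proof. by have := lo_u j; rewrite /next_row /topfill; lia. Qed.

(** Each prefix sum is a minimum of two quantities, one controlled by [u_dom] and the other by
    [v_dom]; this gives dominance. *)
Lemma sum_next_row k : \sum_(j < k) next_row j + v 0 =
  minn (\sum_(j < k) u j + v 0) (\sum_(j < k.+1) v j + (v 0 - al 0)).
Proof.
have s1 : \sum_(j < k.+1) v j = v 0 + \sum_(j < k) v j.+1 by apply: sum_recl.
have s2 : \sum_(j < k) u j = \sum_(j < k) v j.+1 + \sum_(j < k) (u j - v j.+1).
  by rewrite -big_split /=; apply: eq_bigr => j _; have := lo_u j; lia.
have s3 : \sum_(j < k) next_row j = \sum_(j < k) v j.+1 + minn (v 0 - al 0) (\sum_(j < k) (u j - v j.+1)).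
  by rewrite -(sum_topfill (fun i => u i - v i.+1)) -big_split.
rewrite s1 s2 s3; lia.
Qed.

Lemma step_with_max : exists w : nat -> nat,
  [/\ forall i, v i.+1 <= w i <= v i,
      (forall i, w i + p i.+1 <= A i.+1) /\ \sum_(j < l) w j = A 1,
      forall k, k < l -> \sum_(j < k) al j.+1 <= \sum_(j < k) w j,
      w m0 < v m0 &
      bf 0 -> exists2 j, 0 < j & w j < v j].
Proof.
have v0 := v0_ge; have r0 := A_rec l_gt0.
have u_v j : u j <= v j by rewrite /u /e; lia.
have slS : \sum_(j < l.+1) v j = A 0 by rewrite sum_recr v_sum v_l ?addn0.
have sl : \sum_(j < l) next_row j = A 1.
  have := sum_next_row l; rewrite slS.
  have lt1 : l.-1 < l by lia.
  have := u_dom lt1; have := sum_al1 lt1; rewrite prednK // (A_0 (leqnn l)).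
  have := sum_mono u (leq_pred l); have : v 0 <= A 0 by have := v_bnd 0; lia.
  lia.
exists next_row; split.
- move=> i; rewrite (leq_trans (next_row_le i)) ?u_v // andbT /next_row; exact: leq_addr.
- split=> // i; have := next_row_le i; have := v_bnd i.+1; rewrite /u /C; lia.
- move=> k lt; have := sum_next_row k; have := u_dom lt; have := v_dom lt.
  have := sum_al1 lt; have := sum_al lt; lia.
- have := next_row_le m0; rewrite /u /e eqxx; have := v0_ge2; rewrite -vm0; lia.
move=> b0; case: (boolP [exists j : 'I_l, (0 < j) && (next_row j < v j)]) => [/existsP[j /andP[j0 h]]|/existsPn no].
  by exists j.
(* If the strip lay in row 0 alone, then [next_row 0 = v 0 - al 0]. So either [v 1 = 0], hence
   [v 0 = A 0], or the cap [C 0] is attained (not [e 0], as [al 0 >= 2]), hence [v 0 = A 0 - p 1].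
   Both contradict [v_bnd 0], because [p 0 = 1 + p 1]. *)
have pr := p_rec l_gt0; rewrite b0 in pr.
have tail : \sum_(j < l) next_row j + v 0 = next_row 0 + \sum_(j < l) v j.
  case: l l_gt0 no => // l' _ no; rewrite !big_ord_recl -!/(_ 0).
  have -> : \sum_(i < l') next_row (lift ord0 i) = \sum_(i < l') v (lift ord0 i).
    apply: eq_bigr => j _; have := no (lift ord0 j); rewrite lift0 /=.
    by have := next_row_le j.+1; have := u_v j.+1; lia.
  by rewrite /=; lia.
have n0 : next_row 0 + al 0 = v 0 by lia.
have b := v_bnd 0; have b1 := v_bnd 1.
have := sum_next_row 1; rewrite !sum_recr !big_ord0 !add0n.
have ge2 := al_ge2 l_gt0.
have vz : v 1 = 0 -> v 0 = A 0.
  move=> v10; rewrite -v_sum; case: l l_gt0 => // l' _; rewrite big_ord_recl big1 ?addn0 // => j _.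
  by apply/eqP; rewrite -leqn0 -v10 v_anti.
by rewrite /u /e /C; lia.
Qed.

End WithMax.

Lemma step_exists : exists (w : nat -> nat) m0,
  [/\ forall i, v i.+1 <= w i <= v i,
      (forall i, w i + p i.+1 <= A i.+1) /\ \sum_(j < l) w j = A 1,
      forall k, k < l -> \sum_(j < k) al j.+1 <= \sum_(j < k) w j,
      v m0 = v 0 /\ w m0 < v m0 &
      bf 0 -> exists2 j, 0 < j & w j < v j].
Proof.
have [m h1 h2] := last_max_row; have [w [H1 H2 H3 H4 H5]] := step_with_max h1 h2.
by exists w, m.
Qed.

End Step.

(** * Existence of chains *)

Definition admissible (L : seq (nat * bool)) (nu : seq nat) : Prop :=
  [/\ is_partition nu, sumn nu = sumn (unzip1 L),
      forall k, sumn (take k (unzip1 L)) <= sumn (take k nu) &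
      forall i, nth 0 nu i + count snd (drop i L) <= sumn (drop i (unzip1 L))].

(** By interlacing, the rows of [nu] after row [k] have at most as many cells as the rows of [nu1]
    from row [k] on; the sums are arranged to avoid subtraction. *)
Lemma hstrip_prefix nu nu1 k : hstrip nu nu1 ->
  sumn nu + \sum_(j < k) nth 0 nu1 j <= sumn nu1 + \sum_(j < k.+1) nth 0 nu j.
Proof.
move/hstripP=> h.
have mono d : \sum_(j < (k + d).+1) nth 0 nu j + \sum_(j < k) nth 0 nu1 j <=
              \sum_(j < k + d) nth 0 nu1 j + \sum_(j < k.+1) nth 0 nu j.
  elim: d => [|d IH]; first by rewrite addn0; lia.
  rewrite addnS sum_recr (sum_recr (fun j => nth 0 nu1 j)).
  by have := h (k + d); lia.
have := mono (size nu + size nu1).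
rewrite (@sumn_nth nu (k + (size nu + size nu1)).+1) ?(@sumn_nth nu1 (k + (size nu + size nu1))); lia.
Qed.

Lemma hstrip_row0 nu nu1 a : hstrip nu nu1 -> sumn nu = sumn nu1 + a ->
  nth 0 nu 0 <= nth 0 nu1 0 + a.
Proof.
move=> h sz; have := hstrip_prefix 0 h; rewrite big_ord0 big_ord1 => _.
have : sumn nu1 + nth 0 nu 0 <= sumn nu + nth 0 nu1 0; last by lia.
set K := (size nu + size nu1).
rewrite -(@sumn_nth nu K.+1) -?(@sumn_nth nu1 K.+1) /K; try lia.
rewrite (sum_recl (fun i => nth 0 nu1 i)) (sum_recl (fun i => nth 0 nu i)).
suff : \sum_(i < size nu + size nu1) nth 0 nu1 i.+1 <= \sum_(i < size nu + size nu1) nth 0 nu i.+1 by lia.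
by apply: leq_sum => i _; have := hstripP _ _ h i.+1; lia.
Qed.

Lemma hstrip_row0_strict nu nu1 a j : hstrip nu nu1 -> sumn nu = sumn nu1 + a ->
  0 < j -> nth 0 nu1 j < nth 0 nu j -> nth 0 nu 0 < nth 0 nu1 0 + a.
Proof.
move=> h sz j0 lt.
have : sumn nu1 + nth 0 nu 0 < sumn nu + nth 0 nu1 0; last by lia.
set K := (size nu + size nu1) + j.
rewrite -(@sumn_nth nu K.+1) -?(@sumn_nth nu1 K.+1) /K; try lia.
rewrite (sum_recl (fun i => nth 0 nu1 i)) (sum_recl (fun i => nth 0 nu i)).
suff : \sum_(i < size nu + size nu1 + j) nth 0 nu1 i.+1 < \sum_(i < size nu + size nu1 + j) nth 0 nu i.+1 by lia.
have lt1 : j.-1 < size nu + size nu1 + j by lia.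
rewrite (bigD1 (Ordinal lt1)) //= [X in _ < X](bigD1 (Ordinal lt1)) //= prednK //.
rewrite -addSn; apply: leq_add => //.
by apply: leq_sum => i _; have := hstripP _ _ h i.+1; lia.
Qed.

(** The second conclusion feeds the induction: a descent needs a cell of the previous strip outside
    row 0, so that strip shortens row 0 by less than its size. *)
Lemma chain_count_admissible L pb pnu nu : ~~ (last (0, false) L).2 -> is_partition nu ->
  0 < chain_count L pb pnu nu ->
  admissible L nu /\ (pb -> L <> [::] -> exists2 j, 0 < j & nth 0 nu j < nth 0 pnu j).
Proof.
elim: L pb pnu nu => [|[a b] L IH] pb pnu nu lL pn.
  by rewrite /= lt0b => /eqP ->; split=> //; split=> // i; rewrite nth_nil.
rewrite [chain_count _ _ _ _]/= => gt0.
have [nu1] : exists2 nu1, nu1 \in partitions (sumn nu - a) &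
   [&& a <= sumn nu, hstrip nu nu1 & pb ==> desc nu1 nu pnu] && (0 < chain_count L b nu nu1).
  apply/hasP; apply: contraLR gt0 => /hasPn h; rewrite -leqNgt leqn0 sum_nat_seq_eq0.
  apply/allP => nu1 /h; case: and3P => //= _; by rewrite -leqNgt leqn0 => ->.
rewrite mem_partitions => /andP[p1 /eqP s1] /andP[/and3P[lea h hd] gt1].
have lL' : ~~ (last (0, false) L).2 by move: lL => /=; case: (L).
have [[_ s2 dom bnd] ex] := IH b nu nu1 lL' p1 gt1.
have sz : sumn nu = sumn nu1 + a by lia.
split; last first.
  move=> pbT _; move: hd; rewrite pbT /= => /descP[i [j [ij _ lt]]].
  by exists j => //; lia.
split=> //=; first by lia.
- case=> [|k] //=; have := hstrip_prefix k h; have := dom k.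
  by rewrite !sumn_take_nth; lia.
case=> [|i] /=; last first.
  by have := bnd i; have := hstripP _ _ h i; lia.
have := bnd 0; rewrite !drop0; case: b lL ex {gt1 gt0} => lL ex; last by have := hstrip_row0 h sz; lia.
have [|j j0 lt] := ex isT; first by move: lL => /=; case: (L).
by have := hstrip_row0_strict h sz j0 lt; lia.
Qed.

Lemma count_flags_le (L : seq (nat * bool)) i : ~~ (last (0, false) L).2 ->
  count snd (drop i L) <= size L - i.+1.
Proof.
case/lastP: L => [|M y]; first by rewrite /= .
rewrite last_rcons => ny; rewrite size_rcons subSS.
case: (leqP i (size M)) => [le|lt]; last by rewrite drop_oversize ?size_rcons.
rewrite drop_rcons // -cats1 count_cat /= (negbTE ny) !addn0.
by rewrite -size_drop count_size.
Qed.

(** The condition under [pb] is what [step_exists] guarantees for the strip chosen one step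
    earlier. *)
Lemma admissible_chain_count L (pb : bool) pnu nu : sorted geq (unzip1 L) -> all (fun a => 2 <= a) (unzip1 L) ->
  ~~ (last (0, false) L).2 -> admissible L nu ->
  (pb -> [/\ L <> [::], hstrip pnu nu & exists2 j, 0 < j & nth 0 nu j < nth 0 pnu j]) ->
  0 < chain_count L pb pnu nu.
Proof.
elim: L pb pnu nu => [|[a b] L IH] pb pnu nu srt ge2 lL [pn sz dom bnd] hpb.
  rewrite /= lt0b; apply/eqP; apply: size0nil; have := size_partition_le pn; rewrite sz /=; lia.
set L0 := (a, b) :: L in srt ge2 lL sz dom bnd hpb *.
have szu : size (unzip1 L0) = size L0 by rewrite size_map.
have nu_l i : size L0 <= i -> nth 0 nu i = 0.
  by move=> le; have := bnd i; rewrite [drop i (unzip1 L0)]drop_oversize ?szu //=; lia.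
have szn : size nu <= size L0.
  by rewrite leqNgt -is_partition_nth_gt0 // nu_l.
have tr : transitive geq by move=> x y z xy yz; apply: leq_trans yz xy.
pose al i := nth 0 (unzip1 L0) i.
pose A i := sumn (drop i (unzip1 L0)).
pose p i := count snd (drop i L0).
pose bf i := (nth (0, false) L0 i).2.
have g1 i j : i <= j -> j < size L0 -> al j <= al i.
  move=> ij jl; apply: (sorted_leq_nth tr (fun x => leqnn x) 0 srt) => //; rewrite inE szu //.
  exact: leq_ltn_trans ij jl.
have g2 i : i < size L0 -> 2 <= al i.
  by move=> il; apply: (all_nthP 0 ge2); rewrite szu.
have g3 i : i < size L0 -> A i = al i + A i.+1.
  by move=> il; rewrite /A (drop_nth 0) ?szu.
have g4 i : size L0 <= i -> A i = 0 by move=> le; rewrite /A drop_oversize ?szu.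
have g5 i : i < size L0 -> p i = bf i + p i.+1.
  by move=> il; rewrite /p (drop_nth (0, false)).
have g6 i : p i <= size L0 - i.+1 by apply: count_flags_le.
have g7 : \sum_(j < size L0) nth 0 nu j = A 0 by rewrite sumn_nth // sz /A drop0.
have g8 k : k <= size L0 -> \sum_(j < k) al j <= \sum_(j < k) nth 0 nu j.
  by move=> _; have := dom k; rewrite !sumn_take_nth.
have [w [m0 [w1 [w2 w3] w4 [w5 w6] w7]]] :=
  @step_exists (size L0) al A p (fun i => nth 0 nu i) bf isT g1 g2 g3 g4 g5 g6
   (fun i => is_partition_nth i pn) bnd g7 g8.
have wd i : w i.+1 <= w i by have := w1 i; have := w1 i.+1; lia.
have w0 : w (size L) = 0 by have := w2 (size L); rewrite g4 //; lia.
have [pw nw] := seq_ofP wd w0.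
have A1 : A 1 = sumn (unzip1 L) by rewrite /A /= drop0.
have sw : sumn (seq_of w (size L)) = sumn (unzip1 L).
  by rewrite sumn_seq_of // -A1 -w3 /= sum_recr w0 addn0.
have hw : hstrip nu (seq_of w (size L)) by apply/hstripP => i; rewrite nw.
have adw : admissible L (seq_of w (size L)).
  split=> // [k|i]; last by rewrite nw; have := w2 i; rewrite /p /A.
  case: (ltnP k (size L0)) => [lt|le].
    rewrite !sumn_take_nth; under [X in _ <= X]eq_bigr => i _ do rewrite nw.
    exact: w4.
  rewrite take_oversize ?size_map; last by apply: leq_trans le; rewrite /L0 /=.
  rewrite -sw take_oversize // leqNgt; apply/negP => lt.
  have : 0 < nth 0 (seq_of w (size L)) k by rewrite is_partition_nth_gt0.
  by rewrite nw; have := w2 k; rewrite g4 ?(leqW le) //; lia.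
have lL' : ~~ (last (0, false) L).2 by move: lL => /=; case: (L).
have gt1 : 0 < chain_count L b nu (seq_of w (size L)).
  apply: IH => //; first by move: srt => /= /path_sorted.
    by case/andP: ge2.
  move=> bT; split=> //; first by move=> Ln; move: lL; rewrite /L0 Ln /= bT.
  by have [|j j0 lt] := w7; [rewrite /bf /= | exists j => //; rewrite nw].
rewrite [chain_count _ _ _ _]/=.
have wi : seq_of w (size L) \in partitions (sumn nu - a).
  by rewrite mem_partitions pw sw sz /= addKn eqxx.
rewrite big_mkcond (bigD1_seq _ wi) ?partitions_uniq //= hw sz leq_addr /=.
suff -> : pb ==> desc (seq_of w (size L)) nu pnu by apply: leq_trans gt1 (leq_addr _ _).
(* By interlacing, [nth 0 nu j < nth 0 pnu j <= nth 0 nu j.-1], so row [j] of [nu] is shorter than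
   row 0. Row [m0] is as long as row 0, whence [m0 < j]. *)
apply/implyP => /hpb[_ /hstripP hp [j j0 lt]]; apply/descP; exists m0, j; rewrite nw; split=> //.
rewrite ltnNge; apply/negP => le.
have anti := antimono_nth (fun i => is_partition_nth i pn).
have := hp j.-1; rewrite prednK // => /andP[h1 h2].
by have := anti _ _ le; have := anti 0 j.-1 isT; lia.
Qed.

(** * The support of a ribbon and its overlaps *)

Section Flags.
Variables lam mu : seq nat.
Notation l := (size lam).
Notation L := (rows lam mu 1 l).

Lemma part_lam_gt i : l < i -> part lam i = 0.
Proof. by move=> lt; rewrite /part nth_default //; lia. Qed.

Lemma size_rows : size L = l.
Proof. by rewrite size_map size_iota. Qed.

Lemma last_rows : ~~ (last (0, false) L).2.
Proof.
case: (posnP l) => [->|l0] //; rewrite -nth_last size_rows (nth_map 0) ?size_iota; last by lia.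
by rewrite nth_iota; [rewrite /= /overlap part_lam_gt; lia | lia].
Qed.

Lemma column_length_rec i j :
  column_length_from lam mu i j = ((i, j) \in diagram lam mu) + column_length_from lam mu i.+1 j.
Proof.
rewrite /column_length_from -(count_uniq_mem (i, j) (diagram_uniq lam mu)) -count_predUI.
rewrite [X in _ = _ + X](eq_count (a2 := pred0)) ?count_pred0 ?addn0.
  by apply: eq_count => -[a b] /=; rewrite xpair_eqE; lia.
by move=> [a b] /=; rewrite xpair_eqE; lia.
Qed.

End Flags.

Section Support.
Variables (alpha lam mu : seq nat).
Hypotheses (plam : is_partition lam) (pmu : is_partition mu).
Hypothesis row_ge2 : forall i, 1 <= i <= size lam -> part mu i + 2 <= part lam i.
Hypothesis row_next : forall i, 1 <= i -> part lam i.+1 <= (part mu i).+1.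
Notation l := (size lam).
Notation L := (rows lam mu 1 l).

Lemma column_length_0 i j : 1 <= i -> part lam i < j -> column_length_from lam mu i j = 0.
Proof.
move=> i1 lt; rewrite /column_length_from; apply/eqP; rewrite -leqn0 leqNgt -has_count.
apply/hasPn => -[a b]; rewrite mem_diagram /= => h; apply/negP => /andP[ia /eqP eb].
by have := part_anti plam i1 ia; lia.
Qed.

(** Adding row [i] on top can create a column of length two only at its first column. The columns
    counted before are not met by row [i], since row [i.+1] has at least two cells. *)
Lemma overlap_rec i : 1 <= i <= l ->
  count (fun j => column_length_from lam mu i j == 2) (iota 1 (part lam 1)) =
  overlap lam mu i + count (fun j => column_length_from lam mu i.+1 j == 2) (iota 1 (part lam 1)).
Proof.
move=> hi; have i1 : 1 <= i by lia.
have g1 := row_ge2 hi; have n1 := row_next i1; have n2 := @row_next i.+1 isT.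
have le1 := part_anti plam (leqnn 1) i1.
have mu_le : part mu i.+1 <= part mu i by apply: part_anti.
have next2 : part lam i.+2 <= part mu i.
  case: (ltnP i l) => h; last by rewrite part_lam_gt //; lia.
  by have := @row_ge2 i.+1; lia.
rewrite -[overlap lam mu i : nat]/(nat_of_bool _).
have -> : nat_of_bool (overlap lam mu i) =
    count (fun j => (j == (part mu i).+1) && overlap lam mu i) (iota 1 (part lam 1)).
  case: (overlap lam mu i).
    rewrite (eq_count (a2 := pred1 (part mu i).+1)); last by move=> j; rewrite andbT.
    by rewrite count_uniq_mem ?iota_uniq // mem_iota; lia.
  by rewrite (eq_count (a2 := pred0)) ?count_pred0 // => j; rewrite andbF.
rewrite -count_predUI [X in _ = _ + X](eq_count (a2 := pred0)) ?count_pred0 ?addn0; last first.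
  move=> j /=; case: eqP => //= -> {j}; case: (boolP (overlap lam mu i)) => //= ov.
  rewrite column_length_rec column_length_0; [|lia|lia].
  by case: (_ \in _).
apply: eq_count => j /=; rewrite column_length_rec mem_diagram i1 /=.
case: (boolP (part mu i < j <= part lam i)) => h; last first.
  rewrite add0n (_ : (j == (part mu i).+1) = false) //; apply/negbTE/negP => /eqP ej.
  by case/negP: h; lia.
rewrite column_length_rec column_length_0; [|lia|lia].
by rewrite mem_diagram /overlap; case: (boolP (part mu i.+1 < j <= part lam i.+1)) => h' /=; lia.
Qed.

Lemma overlap_countE i : i <= l ->
  count (fun j => column_length_from lam mu i.+1 j == 2) (iota 1 (part lam 1)) = count snd (drop i L).
Proof.
move=> le; have [k] := ubnP (l - i); elim: k i le => // k IH i le lt.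
case: (ltnP i l) => il; last first.
  have -> : i = l by lia.
  rewrite drop_oversize ?size_rows // (eq_in_count (a2 := pred0)) ?count_pred0 // => j.
  by rewrite mem_iota => hj; rewrite column_length_0 // part_lam_gt //; lia.
rewrite overlap_rec ?IH //; try lia.
have e : nth (0, false) L i = (part lam i.+1 - part mu i.+1, overlap lam mu i.+1).
  by rewrite (nth_map 0) ?size_iota // nth_iota.
by rewrite [in RHS](drop_nth (0, false)) ?size_rows // e.
Qed.

Lemma overlapping_nth i : nth 0 (overlapping_partition lam mu) i = count snd (drop i L).
Proof.
case: (ltnP i l) => il; last by rewrite nth_default ?size_map ?size_iota // drop_oversize ?size_rows.
by rewrite (nth_map 0) ?size_iota // nth_iota // add1n overlap_countE // ltnW.
Qed.

Hypothesis alphaE : alpha = [seq part lam i - part mu i | i <- iota 1 (size lam)].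

Lemma unzip1_rows : unzip1 L = alpha.
Proof. by rewrite alphaE /unzip1 -map_comp. Qed.

Lemma size_diagram_alpha : size (diagram lam mu) = sumn alpha.
Proof. by rewrite size_diagram -alphaE. Qed.

Definition ribbon_coef (nu : seq nat) : int :=
  if nu \in partitions (sumn alpha) then Posz (chain_count L false [::] nu) else 0%R.

Lemma ribbon_expansion : is_schur_expansion lam mu ribbon_coef.
Proof.
rewrite /is_schur_expansion size_diagram_alpha; split=> [n|nu /negbTE nin]; last by rewrite /ribbon_coef nin.
rewrite (skew_schurE plam pmu row_ge2 row_next).
have ex : expands (var_at n) n L.
  apply: expandsP; last exact: last_rows.
  by apply/allP => q /mapP[r]; rewrite mem_iota => hr -> /=; have := @row_ge2 r; lia.
rewrite ex unzip1_rows; apply: eq_big_seq => nu nin.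
have := nin; rewrite mem_partitions => /andP[pn _].
by rewrite schurE // /ribbon_coef nin -natz scaler_nat mulr_natl.
Qed.

(** By [schur_independent] any expansion agrees with [ribbon_coef], so its positivity is that of the
    number of chains. *)
Lemma schur_support_admissible nu : is_partition alpha -> all (fun a => 2 <= a) alpha ->
  in_schur_support lam mu nu <-> admissible L nu.
Proof.
move=> alpha_part ge2; split=> [[c [[ex c0] gt]]|ad].
  rewrite size_diagram_alpha in ex c0.
  have nin : nu \in partitions (sumn alpha).
    by case: (boolP (nu \in partitions (sumn alpha))) => // /c0 e; move: gt; rewrite e ltxx.
  have [ex' _] := ribbon_expansion; rewrite size_diagram_alpha in ex'.
  have : (c nu - ribbon_coef nu = 0)%R.
    apply: (@schur_independent (sumn alpha) (fun nu => c nu - ribbon_coef nu)%R) => //.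
    under eq_bigr => ka _ do rewrite scalerBl.
    by rewrite sumrB -ex -ex' subrr.
  move/eqP; rewrite subr_eq0 => /eqP e; move: gt; rewrite e /ribbon_coef nin ltz_nat => gt.
  move: (nin); rewrite mem_partitions => /andP[pn _].
  by have [] := chain_count_admissible (last_rows lam mu) pn gt.
exists ribbon_coef; split; first exact: ribbon_expansion.
have [pn sn _ _] := ad; rewrite unzip1_rows in sn.
rewrite /ribbon_coef mem_partitions pn sn eqxx ltz_nat.
apply: admissible_chain_count => //; rewrite ?unzip1_rows ?last_rows //.
by case/andP: alpha_part.
Qed.

End Support.

Lemma count_pos_nth s i : (forall i, nth 0 s i.+1 <= nth 0 s i) -> (i < num_nonzero s) = (0 < nth 0 s i).
Proof.
elim: s i => [|a s IH] i sd; first by rewrite nth_nil.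
have sd' i' : nth 0 s i'.+1 <= nth 0 s i' := sd i'.+1.
rewrite /num_nonzero /= -/(num_nonzero s); case: (posnP a) => [a0|a0] /=; last first.
  by case: i => [|i] //=; rewrite add1n ltnS IH.
have z j : nth 0 (a :: s) j = 0.
  by have := antimono_nth sd (leq0n j); rewrite /= a0; lia.
rewrite -/(nth 0 (a :: s) i) z add0n ltnn; apply/negbTE; rewrite -leqNgt.
by have := IH 0 sd'; rewrite -[nth 0 s 0]/(nth 0 (a :: s) 1) z ltnn; lia.
Qed.

(** * The dominance interval compared with the row bounds *)

Section Numeric.
Variables (alpha : seq nat) (p : nat -> nat).
Notation l := (size alpha).
Notation al := (nth 0 alpha).
Notation A i := (sumn (drop i alpha)).

(** [varrho] in natural numbers: with parts at least 2 one has [p i <= A i], so the subtraction is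
    exact. *)
Definition rho i := 1 + A i - p i.

Lemma sum_take_drop i : \sum_(j < i) al j + A i = sumn alpha.
Proof. by rewrite -sumn_take_nth -sumn_cat cat_take_drop. Qed.

Lemma row_bound0 nu i : sumn nu = sumn alpha ->
  (forall k, sumn (take k alpha) <= sumn (take k nu)) -> nth 0 nu i <= A i.
Proof.
move=> sn dom; have := dom i; have := sum_take_drop i.
have : \sum_(j < i.+1) nth 0 nu j <= sumn nu.
  by rewrite -sumn_take_nth -{2}(cat_take_drop i.+1 nu) sumn_cat leq_addr.
by rewrite sum_recr !sumn_take_nth; lia.
Qed.

Lemma sumn_drop_ge2 i : all (fun a => 2 <= a) alpha -> 2 * (l - i) <= A i.
Proof.
move=> alpha_ge2; rewrite -size_drop.
have : all (fun a => 2 <= a) (drop i alpha).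
  by move: alpha_ge2; rewrite -{1}(cat_take_drop i alpha) all_cat => /andP[].
by elim: (drop i alpha) => //= a s IH /andP[a2 /IH]; lia.
Qed.

Hypotheses (alpha_part : is_partition alpha) (alpha_ge2 : all (fun a => 2 <= a) alpha).
Hypothesis p_le : forall i, p i <= l - i.+1.

Lemma al_anti i j : i <= j -> al j <= al i.
Proof. exact: (antimono_nth (fun i => is_partition_nth i alpha_part)). Qed.

Lemma sum_max_rho i r : \sum_(j < i) maxn (al j) r = \sum_(j < i) al j + \sum_(j < i) (r - al j).
Proof. by rewrite -big_split /=; apply: eq_bigr => j _; lia. Qed.

(** As [al] decreases, the maximum is [al j] on a first stretch, where dominance applies, and [r]
    afterwards, where [nu] is at least its row [i]. *)
Lemma sum_max_le nu i r : is_partition nu -> (forall k, sumn (take k alpha) <= sumn (take k nu)) ->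
  r <= nth 0 nu i -> \sum_(j < i) maxn (al j) r <= \sum_(j < i) nth 0 nu j.
Proof.
move=> pn dom ler; have anti := antimono_nth (fun i => is_partition_nth i pn).
suff H t : t <= i -> \sum_(j < t) maxn (al j) r <= \sum_(j < t) nth 0 nu j by apply: H.
elim: t => [|t IH] le; first by rewrite !big_ord0.
case: (leqP r (al t)) => h.
  have -> : \sum_(j < t.+1) maxn (al j) r = \sum_(j < t.+1) al j.
    by apply: eq_bigr => j _; have := al_anti (ltn_ord j : j <= t); lia.
  by rewrite -!sumn_take_nth.
rewrite (sum_recr (fun j => maxn (al j) r)) sum_recr.
by have := IH (ltnW le); have := anti t i (ltnW le); lia.
Qed.

Lemma row_bound nu i : is_partition nu -> sumn nu = sumn alpha ->
  (forall k, sumn (take k alpha) <= sumn (take k nu)) ->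
  p i <= \sum_(j < i) (rho i - al j) -> nth 0 nu i + p i <= A i.
Proof.
move=> pn sn dom cond; rewrite leqNgt; apply/negP => gt.
have ler : rho i <= nth 0 nu i by rewrite /rho; lia.
have := sum_max_le pn dom ler; rewrite sum_max_rho.
have : \sum_(j < i.+1) nth 0 nu j <= sumn nu.
  by rewrite -sumn_take_nth -{2}(cat_take_drop i.+1 nu) sumn_cat leq_addr.
rewrite sum_recr; have := sum_take_drop i.
have : rho i + p i = 1 + A i by rewrite /rho; have := sumn_drop_ge2 i alpha_ge2; have := p_le i; lia.
lia.
Qed.

(** Row [i] gets the least violating value [r], every earlier row is raised to at least [r], and the
    [p i - 1 - s] cells that remain go to row 0. *)
Lemma violating_partition i : 0 < i < l -> \sum_(j < i) (rho i - al j) < p i ->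
  exists nu, [/\ is_partition nu, sumn nu = sumn alpha,
    forall k, sumn (take k alpha) <= sumn (take k nu),
    nth 0 nu 0 + p 0 <= sumn alpha & A i < nth 0 nu i + p i].
Proof.
move=> /andP[i0 il] lt; set s := \sum_(j < i) _ in lt.
have Ai := sumn_drop_ge2 i alpha_ge2; have pi := p_le i; have p0 := p_le 0.
set r := rho i in s lt *.
have rE : r + p i = 1 + A i by rewrite /r /rho; lia.
pose f j := if j < i then maxn (al j) r + (if j == 0 then p i - 1 - s else 0)
            else if j == i then r else 0.
have fd j : f j.+1 <= f j.
  rewrite /f; have := al_anti (leqnSn j); case: (ltnP j.+1 i) => h.
    by rewrite (ltnW h) /= addn0; lia.
  case: eqP => // ej _; rewrite -[j < i]/(j.+1 <= i) ej leqnn; lia.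
have fz : f i.+1 = 0 by rewrite /f ltnNge leqnSn /= (_ : (i.+1 == i) = false) //; lia.
have [pn nf] := seq_ofP fd fz.
have fi : f i = r by rewrite /f ltnn eqxx.
have f0 : f 0 = maxn (al 0) r + (p i - 1 - s) by rewrite /f i0.
have sumf k : 0 < k <= i -> \sum_(j < k) f j = \sum_(j < k) maxn (al j) r + (p i - 1 - s).
  case: k => // k /= ki.
  rewrite (sum_recl f) (sum_recl (fun j => maxn (al j) r)) f0.
  have -> : \sum_(j < k) f j.+1 = \sum_(j < k) maxn (al j.+1) r; last by lia.
  by apply: eq_bigr => j _; rewrite /f (leq_trans _ ki) ?ltnS //= addn0.
have sn : sumn (seq_of f i.+1) = sumn alpha.
  rewrite sumn_seq_of // sum_recr sumf ?i0 ?leqnn // sum_max_rho -/s fi.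
  by have := sum_take_drop i; lia.
exists (seq_of f i.+1); split=> //.
- move=> k; case: (leqP k i) => ki.
    case: (posnP k) => [->|k0]; first by rewrite !take0.
    rewrite !sumn_take_nth; under [X in _ <= X]eq_bigr => j _ do rewrite nf.
    rewrite sumf ?k0 //; apply: leq_trans (leq_addr _ _).
    by apply: leq_sum => j _; apply: leq_maxl.
  have -> : sumn (take k (seq_of f i.+1)) = sumn alpha.
    rewrite take_oversize // size_filter; apply: leq_trans (count_size _ _) _.
    by rewrite size_mkseq.
  by rewrite -[X in _ <= sumn X](cat_take_drop k) sumn_cat leq_addr.
- rewrite nf; have := sum_antimono_ge i fd; have := sumn_seq_of fd fz.
  rewrite sn sum_recr fi => e1 e2.
  (* The [i] rows after row 0 have at least [r >= l - i + 1] cells each, hence together at least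
     [l > p 0]; this is the room needed for the bound on row 0. *)
  have : i + (l - i) <= i * r.
    have r2 : (l - i).+1 <= r by lia.
    have := leq_mul (leqnn i) r2; rewrite mulnS.
    have : l - i <= i * (l - i) by rewrite -[X in X <= _]mul1n leq_mul.
    lia.
  lia.
by rewrite nf fi; lia.
Qed.

End Numeric.

Lemma sum_drop_int (s : seq nat) (i : nat) : i <= size s ->
  (\sum_(i.+1 <= q < (size s).+1) (part s q)%:Z = (sumn (drop i s))%:Z)%R.
Proof.
move=> le; rewrite big_add1 /= (eq_bigr (fun q => Posz (nth 0 s q))) // -(big_morph Posz PoszD (erefl _)).
congr Posz; rewrite sumnE [RHS](big_nth 0) size_drop -{1}[i]add0n big_addn.
by apply: eq_bigr => j _; rewrite nth_drop addnC.
Qed.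

Lemma pos_part_subz (r a : nat) : pos_part (r%:Z - a%:Z)%R = Posz (r - a).
Proof. by rewrite /pos_part; case: leP; lia. Qed.

Theorem theorem1p7 (alpha p lam mu : seq nat)
  (alpha_part : is_partition alpha)
  (alpha_ge2 : all (fun a => 2 <= a) alpha)
  (ribbon_alpha : is_ribbon alpha lam mu)
  (p_overlap : p = overlapping_partition lam mu) :
  (forall nu : seq nat,
     in_schur_support lam mu nu <->
     in_dominance_interval alpha [:: sumn alpha - part p 1; part p 1] nu)
  <->
  (num_nonzero p < 2 \/
   (2 <= num_nonzero p /\
    forall i : nat, 1 <= i <= num_nonzero p - 1 ->
      ((part p i.+1)%:Z <=
       \sum_(1 <= j < i.+1) pos_part (varrho alpha p i - (part alpha j)%:Z))%R)).
Proof.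
have [[plam pmu _] no22 alphaE _ _] := ribbon_alpha.
have row_ge2 i : 1 <= i <= size lam -> part mu i + 2 <= part lam i.
  move=> hi; have : part lam i - part mu i \in alpha.
    by rewrite alphaE; apply: map_f; rewrite mem_iota; lia.
  by move/(allP alpha_ge2) => /=; lia.
have row_next i : 1 <= i -> part lam i.+1 <= (part mu i).+1.
  move=> i1; rewrite leqNgt; apply/negP => lt.
  have h1 := part_anti plam i1 (leqnSn i); have h2 := part_anti pmu i1 (leqnSn i).
  by apply: (no22 i (part mu i).+1); split; rewrite mem_diagram; lia.
have szl : size alpha = size lam by rewrite alphaE size_map size_iota.
set L := rows lam mu 1 (size lam).
have uL : unzip1 L = alpha by apply: unzip1_rows.
pose q i := count snd (drop i L).
have pE i : nth 0 p i = q i by rewrite p_overlap; apply: overlapping_nth.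
have q_le i : q i <= size alpha - i.+1.
  by rewrite szl -(size_rows lam mu); apply: count_flags_le; apply: last_rows.
have q_dec i : nth 0 p i.+1 <= nth 0 p i.
  rewrite !pE /q -addn1 addnC -drop_drop; elim: (drop i L) => //= y s _; rewrite drop0; exact: leq_addl.
have supp nu : in_schur_support lam mu nu <-> admissible L nu.
  exact: (schur_support_admissible plam pmu row_ge2 row_next alphaE nu alpha_part).
have A_ge i := sumn_drop_ge2 i alpha_ge2.
have q0 : q 0 <= sumn alpha by have := q_le 0; have := A_ge 0; rewrite drop0; lia.
have interval nu : in_dominance_interval alpha [:: sumn alpha - part p 1; part p 1] nu <->
    [/\ is_partition nu, sumn nu = sumn alpha,
        forall k, sumn (take k alpha) <= sumn (take k nu) & nth 0 nu 0 + q 0 <= sumn alpha].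
  rewrite /part /= pE; split=> [[pn [s1 d1] [s2 d2]]|[pn s1 d1 b0]].
    split=> //; have := d2 1; rewrite sumn_take_nth big_ord1 /=; lia.
  split=> //; split; rewrite /= ?addn0; try lia.
  case=> [|[|k]]; rewrite ?take0 //; first by rewrite sumn_take_nth big_ord1 /=; lia.
  have : sumn (take k.+2 nu) <= sumn nu by rewrite -{2}(cat_take_drop k.+2 nu) sumn_cat leq_addr.
  by rewrite /=; lia.
have condE i : i <= size alpha ->
    ((part p i.+1)%:Z <= \sum_(1 <= j < i.+1) pos_part (varrho alpha p i - (part alpha j)%:Z))%R
    = (q i <= \sum_(j < i) (rho alpha q i - nth 0 alpha j)).
  move=> le; have -> : varrho alpha p i = Posz (rho alpha q i).
    rewrite /varrho sum_drop_int // /part /= pE /rho; have := A_ge i; have := q_le i; lia.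
  rewrite big_add1 /= big_mkord (eq_bigr (fun j : 'I_i => Posz (rho alpha q i - nth 0 alpha j))).
    by rewrite -(big_morph Posz PoszD (erefl _)) /part /= pE lez_nat.
  by move=> j _; rewrite pos_part_subz.
have adm nu : admissible L nu <->
    [/\ is_partition nu, sumn nu = sumn alpha,
        forall k, sumn (take k alpha) <= sumn (take k nu) &
        forall i, nth 0 nu i + q i <= sumn (drop i alpha)].
  by rewrite /admissible uL.
split=> [full|cond nu].
  case: (ltnP (num_nonzero p) 2) => [|ge2]; first by left.
  right; split=> // i hi.
  have qi : 0 < q i by rewrite -pE -(count_pos_nth _ q_dec); lia.
  have il : i < size alpha by have := q_le i; lia.
  rewrite condE; last by lia.
  rewrite leqNgt; apply/negP => lt.
  have hi' : 0 < i < size alpha by lia.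
  have [nu [pn sn dom b0 viol]] := violating_partition alpha_part alpha_ge2 q_le hi' lt.
  have /supp/adm[_ _ _ bnd] : in_schur_support lam mu nu by apply/full/interval.
  by have := bnd i; lia.
rewrite supp adm interval; split=> [[pn sn dom bnd]|[pn sn dom b0]]; split=> //.
  by have := bnd 0; rewrite drop0.
(* Three sources for the row bounds: dominance where [q i = 0], the upper end of the interval for
   [i = 0], and otherwise the inequality of the theorem, since [q i > 0] puts [i] in its range. *)
move=> i; case: (posnP (q i)) => [->|qi].
  by rewrite addn0; apply: (row_bound0 _ sn dom).
case: (posnP i) => [->|i0]; first by rewrite drop0.
have num : i < num_nonzero p by rewrite (count_pos_nth _ q_dec) pE.
case: cond => [|[_ cond]]; first by lia.
apply: (row_bound alpha_part alpha_ge2 q_le pn sn dom).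
rewrite -condE; first by apply: cond; lia.
by have := q_le i; lia.
Qed.
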